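(* Let $k\in\mathbb{N}_0$ and $r\in[0,\infty)$ be such that $\max\{k,r\}>0$ and let $(x_n)_{n\in\mathbb{N}}$ be a sequence of real numbers converging to $x>0$, such that $(k+r)x_n\log n$ is an integer for all $n\in\mathbb{N}$. Then, as $n\to\infty$, we have the asymptotics $$\mathbb{P}\bigl[\mathrm{Lah}(n,k)_r=(k+r)x_n\log n\bigr]\sim\frac{n^{-(k+r)(x_n\log(x_n)-x_n+1)}}{\sqrt{2\pi(k+r)x\log n}}\,\frac{\Gamma(k+2r)}{\Gamma((k+r)x+r)};$$ if moreover $x>1$, then $$\mathbb{P}\bigl[\mathrm{Lah}(n,k)_r\geq(k+r)x_n\log n\bigr]\sim\frac{x}{x-1}\,\frac{n^{-(k+r)(x_n\log(x_n)-x_n+1)}}{\sqrt{2\pi(k+r)x\log n}}\,\frac{\Gamma(k+2r)}{\Gamma((k+r)x+r)};$$ and if moreover $x<1$, then $$\mathbb{P}\bigl[\mathrm{Lah}(n,k)_r\leq(k+r)x_n\log n\bigr]\sim\frac{1}{1-x}\,\frac{n^{-(k+r)(x_n\log(x_n)-x_n+1)}}{\sqrt{2\pi(k+r)x\log n}}\,\frac{\Gamma(k+2r)}{\Gamma((k+r)x+r)}.$$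
   Context: $\mathbb{N}=\{1,2,\ldots\}$, $\mathbb{N}_0=\mathbb{N}\cup\{0\}$. Let $\genfrac{[}{]}{0pt}{}{n}{k}$ and $\genfrac{\{}{\}}{0pt}{}{n}{k}$ be the (unsigned) Stirling numbers of the first kind (number of permutations of $\{1,\dots,n\}$ with exactly $k$ cycles) and of the second kind (number of partitions of $\{1,\dots,n\}$ into $k$ non-empty subsets). For $n\in\mathbb{N}_0$, $k\in\{0,\ldots,n\}$ and $r\in\mathbb{R}$ the $r$-Stirling numbers are defined (with $0^0=1$) by $$\genfrac{[}{]}{0pt}{}{n}{k}_r=\sum_{j=k}^n\genfrac{[}{]}{0pt}{}{n}{j}\binom{j}{k}r^{j-k},\qquad \genfrac{\{}{\}}{0pt}{}{n}{k}_r=\sum_{j=k}^n\binom{n}{j}\genfrac{\{}{\}}{0pt}{}{j}{k}r^{n-j}.$$ The $r$-Lah number is $L(n,k)_r=\sum_{j=k}^n\genfrac{[}{]}{0pt}{}{n}{j}_r\genfrac{\{}{\}}{0pt}{}{j}{k}_r$. For $n\in\mathbb{N}$, $k\in\{0,\ldots,n\}$, $r\in[0,\infty)$ with $\max\{k,r\}>0$, $\mathrm{Lah}(n,k)_r$ denotes a random variable with the $r$-Lah distribution $$\mathbb{P}[\mathrm{Lah}(n,k)_r=j]=\frac{1}{L(n,k)_r}\genfrac{[}{]}{0pt}{}{n}{j}_r\genfrac{\{}{\}}{0pt}{}{j}{k}_r,\qquad j\in\{k,k+1,\ldots,n\}.$$ $\Gamma$ is Euler's Gamma function; $a_n\sim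 b_n$ means $a_n/b_n\to1$ as $n\to\infty$. *)

(* Defs.v *)
From mathcomp Require Import all_boot all_order all_algebra perm.
From mathcomp Require Import all_classical all_reals all_analysis.
Import Order.TTheory GRing.Theory Num.Theory.
Import numFieldNormedType.Exports.

Set Implicit Arguments.
Unset Strict Implicit.
Unset Printing Implicit Defensive.

Local Open Scope classical_set_scope.
Local Open Scope ring_scope.

Definition stirling1 (n k : nat) : nat :=
  #|[set s : 'S_n | #|porbits s| == k]%SET|.

Definition stirling2 (n k : nat) : nat :=
  #|[set Q : {set {set 'I_n}} | finset.partition Q [set: 'I_n]%SET & #|Q| == k]%SET|.

Definition rstirling1 (R : realType) (n k : nat) (r : R) : R :=
  \sum_(k <= j < n.+1) (stirling1 n j)%:R * 'C(j, k)%:R * r ^+ (j - k).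

Definition rstirling2 (R : realType) (n k : nat) (r : R) : R :=
  \sum_(k <= j < n.+1) 'C(n, j)%:R * (stirling2 j k)%:R * r ^+ (n - j).

Definition rlah (R : realType) (n k : nat) (r : R) : R :=
  \sum_(k <= j < n.+1) rstirling1 n j r * rstirling2 j k r.

Definition rLah_distributed (R : realType) (d : measure_display)
    (T : measurableType d) (P : probability T R) (n k : nat) (r : R)
    (X : {RV P >-> R}) : Prop :=
  forall j : nat, (k <= j <= n)%N ->
    P [set w | X w = j%:R]
    = ((rlah n k r)^-1 * (rstirling1 n j r * rstirling2 j k r))%:E.

(* Euler's integral; it is only meaningful for [0 < z]. *)
Definition Gamma (R : realType) (z : R) : R :=
  \int[lebesgue_measure]_(t in `]0, +oo[) (t `^ (z - 1) * expR (- t)).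

Definition asymp_equiv (R : realType) (a b : nat -> R) : Prop :=
  (fun n => a n / b n) @ \oo --> (1 : R).

(* Main.v *)
(** Write [c = k + r] and [L = ln n].  The numbers [[n, j]_r] are the
coefficients of [prod_(i < n) (v + r + i)], and [k! {j, k}_r] lies between
[c^j - k (c - 1)^j] and [c^j]; hence [k! L(n, k)_r] is asymptotic to
[prod_(i < n) (c + r + i)], which Gauss's product formula evaluates as
[n! n^(c + r - 1) / Gamma (c + r)].

For the numerator, factor [prod_(i < n) (v + r + i)] as
[n! n^(r - 1) e^(L v) H_n(v)].  By Gauss's formula [H_n(v)] tends to
[1 / Gamma (v + r)], and the Weierstrass factors
[(1 + w / i) e^(- w / i) = 1 + O(1 / i^2)] bound the power series of [H_n] in
every weighted l^1 norm, uniformly in [n].  Extracting the coefficient of [v^j]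
with [j ~ y L] therefore replaces [v] by [y] in [H_n] and leaves the Poisson
weight [L^j / j!]: the r-Lah probability of [j] is asymptotic to the Poisson
probability of [j] with rate [c L], times a quotient of Gamma values, and
Stirling's formula evaluates the former.

The sequence [j |-> [n, j]_r] is log-concave, so the terms of both tails are
dominated by geometric sequences whose ratios converge to [1 / x], resp. [x]. *)

Require Import Defs.
From mathcomp Require Import all_boot all_order all_algebra fingroup perm.
From mathcomp Require Import all_classical all_reals all_analysis.
From mathcomp Require Import measurable_realfun.
From mathcomp Require Import ring lra zify.
Import Order.TTheory GRing.Theory Num.Theory.
Import numFieldNormedType.Exports.

Set Implicit Arguments.
Unset Strict Implicit.
Unset Printing Implicit Defensive.

Local Open Scope classical_set_scope.
Local Open Scope ring_scope.

(** * Limits and asymptotic equivalence *)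

Lemma near_eq_cvg_to (T : Type) (U : nbhsType) (F : set_system T)
    (FF : Filter F) (f g : T -> U) (l : U) :
  (\forall t \near F, f t = g t) -> f @ F --> l -> g @ F --> l.
Proof.
move=> fg; apply: cvg_trans; apply: near_eq_cvg.
by apply: filterS fg => t ->.
Qed.

Section asymp_equiv_theory.
Variable R : realType.
Implicit Types (a b c : nat -> R) (q : R).

Lemma asymp_equiv_neq0 a b : asymp_equiv a b ->
  \forall n \near \oo, a n != 0 /\ b n != 0.
Proof.
move=> ab; near=> n; apply/andP.
have /lt0r_neq0 : 0 < a n / b n by near: n; exact: (cvgr_gt _ ab).
by rewrite mulf_eq0 invr_eq0 negb_or.
Unshelve. all: by end_near. Qed.

Lemma asymp_equiv_trans a b c :
  asymp_equiv a b -> asymp_equiv b c -> asymp_equiv a c.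
Proof.
move=> ab bc; rewrite /asymp_equiv -(mulr1 1).
apply: near_eq_cvg_to (cvgM ab bc); near=> n => /=.
have [_ b0] : a n != 0 /\ b n != 0 by near: n; exact: asymp_equiv_neq0.
by rewrite mulrA divfK.
Unshelve. all: by end_near. Qed.

Lemma asymp_equivZl q a b : q != 0 -> asymp_equiv a b ->
  asymp_equiv (fun n => q * a n) (fun n => q * b n).
Proof.
move=> q0; apply: near_eq_cvg_to; near=> n.
by rewrite invfM mulrACA divff // mul1r.
Unshelve. all: by end_near. Qed.

Lemma cvg_asymp_equiv q a b : q != 0 ->
  a n / b n @[n --> \oo] --> q -> asymp_equiv a (fun n => q * b n).
Proof.
move=> q0 ab; rewrite /asymp_equiv -(mulVf q0).
apply: near_eq_cvg_to (cvgM (cvg_cst q^-1) ab); near=> n => /=.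
by rewrite invfM mulrCA.
Unshelve. all: by end_near. Qed.

Lemma near_eq_asymp_equiv a a' b : (\forall n \near \oo, a n = a' n) ->
  asymp_equiv a b -> asymp_equiv a' b.
Proof. by move=> aa'; apply: near_eq_cvg_to; apply: filterS aa' => n ->. Qed.

End asymp_equiv_theory.

(** * Stirling numbers *)

Section big_trim.
Variables (R : Type) (idx : R) (op : Monoid.law idx).
Implicit Types (m n : nat) (F : nat -> R).

Lemma big_nat_trim_lt m n F : (forall i, (i < m)%N -> F i = idx) ->
  \big[op/idx]_(m <= i < n) F i = \big[op/idx]_(i < n) F i.
Proof.
move=> F0; rewrite big_geq_mkord big_mkcond /=; apply: eq_bigr => i _.
by case: leqP => // /F0.
Qed.

Lemma big_ord_trim_ge m n F :
    (m <= n)%N -> (forall i, (m <= i < n)%N -> F i = idx) ->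
  \big[op/idx]_(i < n) F i = \big[op/idx]_(i < m) F i.
Proof.
move=> mn F0; rewrite [RHS](big_ord_widen n) // [RHS]big_mkcond /=.
by apply: eq_bigr => i _; case: ltnP => // mi; rewrite F0 // mi ltn_ord.
Qed.

End big_trim.

Section lift_perm_cycles.
Variable n : nat.
Implicit Types (s : 'S_n) (i : 'I_n).
Local Notation lift0_perm := (lift_perm ord0 ord0).

Lemma lift_permX0 s m : ((lift0_perm s) ^+ m)%g = lift0_perm (s ^+ m)%g.
Proof.
elim: m => [|m IH]; first by rewrite !expg0 lift_perm1.
by rewrite !expgSr IH lift_permM.
Qed.

Lemma porbit_lift_perm s i :
  porbit (lift0_perm s) (lift ord0 i) = (lift ord0 @: porbit s i)%SET.
Proof.
apply/setP => y; apply/porbitP/imsetP => [[m ->]|[j /porbitP[m ->] ->]].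
  by exists ((s ^+ m)%g i); rewrite ?mem_porbit // lift_permX0 lift_perm_lift.
by exists m; rewrite lift_permX0 lift_perm_lift.
Qed.

Lemma porbit_lift_perm0 s : porbit (lift0_perm s) ord0 = [set ord0]%SET.
Proof.
apply/setP => y; rewrite inE; apply/porbitP/eqP => [[m ->]|->].
  by rewrite lift_permX0 lift_perm_id.
by exists 0%N; rewrite expg0 perm1.
Qed.

Lemma card_porbits_lift_perm s : #|porbits (lift0_perm s)| = #|porbits s|.+1.
Proof.
pose lifted := [set lift ord0 @: (B : {set 'I_n}) | B in porbits s]%SET.
have -> : porbits (lift0_perm s) = ([set ord0]%SET |: lifted)%SET.
  apply/setP => B; rewrite !inE; apply/imsetP/orP.
  - move=> [y _ ->]; case: (unliftP ord0 y) => [i ->|->]; last first.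
      by left; rewrite porbit_lift_perm0.
    right; apply/imsetP; exists (porbit s i); first exact: imset_f.
    exact: porbit_lift_perm.
  - case=> [/eqP->|/imsetP[C /imsetP[i _ ->] ->]].
      by exists ord0 => //; rewrite porbit_lift_perm0.
    by exists (lift ord0 i) => //; rewrite porbit_lift_perm.
rewrite cardsU1 card_imset ?add1n; last exact/imset_inj/lift_inj.
case: imsetP => // -[C _ /setP /(_ ord0)]; rewrite !inE eqxx.
by move=> /esym/imsetP[j _ /eqP]; rewrite (negbTE (neq_lift _ _)).
Qed.

Lemma card_porbits_tperm_lift_perm s (i : 'I_n.+1) : i != ord0 ->
  #|porbits (tperm ord0 i * lift0_perm s)%g| = #|porbits s|.
Proof.
move=> i0; have := porbits_mul_tperm (lift0_perm s) ord0 i.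
rewrite /= porbit_sym porbit_lift_perm0 inE i0 eq_sym i0 card_porbits_lift_perm.
by move=> /eqP; rewrite addn1 addn2 !eqSS => /eqP.
Qed.

Lemma tperm_lift_perm_bij : bijective
  (fun p : 'I_n.+1 * 'S_n => (tperm ord0 p.1 * lift0_perm p.2)%g).
Proof.
apply: inj_card_bij; last by rewrite card_prod !card_ord !card_Sn factS.
move=> [i s] [j t] /= eq_prod.
have ij : i = j.
  have := congr1 (fun u : 'S_n.+1 => (u^-1)%g ord0) eq_prod.
  by rewrite !invMg !permM !lift_permV !lift_perm_id !tpermV !tpermL.
rewrite {}ij in eq_prod *; congr pair.
apply/permP => k; apply: (@lift_inj _ ord0).
by rewrite -!(lift_perm_lift ord0) (mulgI _ _ _ eq_prod).
Qed.

End lift_perm_cycles.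

Lemma sum_expr_card_porbits (R : comNzRingType) (x : R) n :
  \sum_(s : 'S_n) x ^+ #|porbits s| = \prod_(i < n) (x + i%:R).
Proof.
elim: n => [|n IH].
  rewrite big_ord0 (big_pred1 1%g) => [|s]; last by apply/esym/eqP/permP => -[].
  suff -> : porbits (1%g : 'S_0) = finset.set0 by rewrite cards0 expr0.
  by apply/setP => B; rewrite inE; apply/imsetP => -[[]].
rewrite big_ord_recr /= -IH (reindex _ (onW_bij _ (@tperm_lift_perm_bij n))) /=.
rewrite -(pair_bigA _ (fun i s =>
  x ^+ #|porbits (tperm ord0 i * lift_perm ord0 ord0 s)%g|)) /=.
rewrite big_ord_recl /= mulrDr; congr (_ + _).
  rewrite mulr_suml; apply: eq_bigr => s _.
  by rewrite tperm1 mul1g card_porbits_lift_perm exprSr.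
rewrite -[X in _ * X%:R]card_ord mulr_natr -sumr_const.
apply: eq_bigr => i _; apply: eq_bigr => s _.
by rewrite card_porbits_tperm_lift_perm // eq_sym neq_lift.
Qed.

Lemma prod_addn_shift (R : comNzRingType) (x : R) n :
  x * \prod_(i < n) (x + 1 + i%:R) = \prod_(i < n) (x + i%:R) * (x + n%:R).
Proof.
transitivity (\prod_(i < n.+1) (x + i%:R)); last exact: big_ord_recr.
rewrite big_ord_recl addr0; congr (_ * _); apply: eq_bigr => i _.
by rewrite lift0 -natr1 -addrA [1 + _]addrC.
Qed.

Lemma prod_addn_gt0 (R : numDomainType) (x : R) n :
  0 < x -> 0 < \prod_(i < n) (x + i%:R).
Proof. by move=> x_gt0; apply: prodr_gt0 => i _; rewrite ltr_wpDr. Qed.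

Lemma card_porbits_le n (s : 'S_n) : (#|porbits s| <= n)%N.
Proof. by rewrite -[leqRHS]card_ord; exact: leq_imset_card. Qed.

Lemma sum_stirling1 (R : comNzRingType) (x : R) n :
  \sum_(j < n.+1) (stirling1 n j)%:R * x ^+ j = \prod_(i < n) (x + i%:R).
Proof.
rewrite -sum_expr_card_porbits.
rewrite (partition_big (fun s => inord #|porbits s| : 'I_n.+1) xpredT) //=.
apply: eq_bigr => j _.
rewrite /stirling1 -sum1dep_card natr_sum mulr_suml.
apply: eq_big => s; first by rewrite -val_eqE /= inordK // ltnS card_porbits_le.
by move=> /eqP ->; rewrite mul1r.
Qed.

Definition rising (R : nzRingType) (n : nat) (r : R) : {poly R} :=
  \prod_(i < n) ('X + (r + i%:R)%:P).

Lemma coef_XaddC_exp (R : comNzRingType) (r : R) n k :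
  (('X + r%:P) ^+ n)`_k = 'C(n, k)%:R * r ^+ (n - k).
Proof.
rewrite addrC exprDn coef_sum.
under eq_bigr => i _ do
  rewrite -polyC_exp coefMn coefCM coefXn mulr_natr mulrnAC mulrb.
rewrite -big_mkcond /= mulr_natl; case: (ltnP k n.+1) => kn.
  by rewrite (big_pred1 (Ordinal kn)) // => i; rewrite -val_eqE eq_sym.
rewrite bin_small // mulr0n big1 // => i /eqP ik.
by move: (ltn_ord i); rewrite -ik ltnNge kn.
Qed.

Section rising_theory.
Variables (R : comNzRingType) (r : R).

Lemma rising_recr n : rising n.+1 r = rising n r * ('X + (r + n%:R)%:P).
Proof. exact: big_ord_recr. Qed.

Lemma horner_rising n v : (rising n r).[v] = \prod_(i < n) (v + r + i%:R).
Proof.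
rewrite /rising horner_prod; apply: eq_bigr => i _.
by rewrite hornerD hornerX hornerC addrA.
Qed.

Lemma size_rising n : size (rising n r) = n.+1.
Proof.
elim: n => [|n IH]; first by rewrite /rising big_ord0 size_poly1.
rewrite rising_recr size_Mmonic ?monicXaddC ?size_XaddC ?IH ?addn2 //.
by rewrite -size_poly_eq0 IH.
Qed.

Lemma risingE n :
  rising n r = \sum_(j < n.+1) (stirling1 n j)%:R * ('X + r%:P) ^+ j.
Proof.
rewrite sum_stirling1; apply: eq_bigr => i _.
by rewrite polyCD addrA polyC_natr.
Qed.

End rising_theory.

Lemma rstirling1E (R : realType) n k (r : R) :
  rstirling1 n k r = (rising n r)`_k.
Proof.
rewrite /rstirling1 big_nat_trim_lt => [|j jk]; last first.
  by rewrite bin_small // mulr0 mul0r.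
rewrite risingE coef_sum; apply: eq_bigr => j _.
by rewrite [in RHS]mulr_natl coefMn coef_XaddC_exp -[RHS]mulr_natl mulrA.
Qed.

Lemma sum_rstirling1 (R : realType) n (r v : R) :
  \sum_(j < n.+1) rstirling1 n j r * v ^+ j = \prod_(i < n) (v + r + i%:R).
Proof.
rewrite -horner_rising horner_coef size_rising.
by apply: eq_bigr => j _; rewrite rstirling1E.
Qed.

Lemma card_partition_leq (T : finType) (Q : {set {set T}}) (D : {set T}) :
  finset.partition Q D -> (#|Q| <= #|D|)%N.
Proof.
move=> PQ; rewrite (finset.card_partition PQ) -sum1_card.
apply: leq_sum => B BQ; rewrite card_gt0; have [_ _ Q0] := and3P PQ.
by apply: contraNneq Q0 => <-.
Qed.

Lemma eq_preim_partition (T rT1 rT2 : finType) (f : T -> rT1) (g : T -> rT2)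
    (D : {set T}) :
  (forall i j, (f i == f j) = (g i == g j)) ->
  preim_partition f D = preim_partition g D.
Proof.
by move=> fg; apply: eq_imset => i; apply/setP => j; rewrite !inE fg.
Qed.

(* A function with fibre partition [Q] is an injection of the blocks of [Q]. *)
Lemma card_ffun_preim_partition (T rT : finType) (Q : {set {set T}}) :
  finset.partition Q [set: T]%SET ->
  #|[set f : {ffun T -> rT} | preim_partition f [set: T]%SET == Q]%SET|
    = #|rT| ^_ #|Q|.
Proof.
move=> PQ; have [/eqP cQ tQ Q0] := and3P PQ.
have pblockQ i : finset.pblock Q i \in Q.
  by apply: finset.pblock_mem; rewrite cQ inE.
pose block := {B : {set T} | B \in Q}.
pose block_of i : block := Sub (finset.pblock Q i) (pblockQ i).
have block_inhabited (B : block) : exists i, i \in val B.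
  by apply/set0Pn; apply: contraNneq Q0 => <-; exact: (valP B).
have block_ofE (B : block) i : i \in val B -> block_of i = B.
  by move=> iB; apply: val_inj => /=; apply: finset.def_pblock (valP B) iB.
pose lift_block (g : {ffun block -> rT}) := [ffun i => g (block_of i)].
have lift_block_inj : injective lift_block.
  move=> g h gh; apply/ffunP => B; have [i iB] := block_inhabited B.
  by move/ffunP/(_ i): gh; rewrite !ffunE (block_ofE _ _ iB).
have -> : #|Q| = #|{: block}| by rewrite card_sig; apply: eq_card.
rewrite -card_inj_ffuns -(card_imset _ lift_block_inj).
apply: eq_card => f; rewrite inE; apply/eqP/imsetP => [fQ|[g]]; last first.
  rewrite inE => /injectiveP ginj ->.
  rewrite -[RHS](finset.preim_partition_pblock PQ).
  by apply: eq_preim_partition => i j; rewrite !ffunE (inj_eq ginj) -val_eqE.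
have f_eqE i j : (f i == f j) = (block_of i == block_of j).
  rewrite -val_eqE /= finset.eq_pblock //; last by rewrite cQ inE.
  rewrite -fQ finset.pblock_equivalence_partition //.
  by apply: in3W; split => // /eqP ->.
pose repr B := xchoose (block_inhabited B).
have reprK B : block_of (repr B) = B.
  exact/block_ofE/(xchooseP (block_inhabited B)).
exists [ffun B => f (repr B)]; last first.
  by apply/ffunP => i; rewrite !ffunE; apply/eqP; rewrite f_eqE reprK.
rewrite inE; apply/injectiveP => B C; rewrite !ffunE => /eqP.
by rewrite f_eqE !reprK => /eqP.
Qed.

Lemma sum_stirling2 n x :
  (\sum_(m < n.+1) stirling2 n m * x ^_ m = x ^ n)%N.
Proof.
have -> : (x ^ n)%N = #|{: {ffun 'I_n -> 'I_x}}| by rewrite card_ffun !card_ord.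
rewrite -sum1_card.
rewrite (partition_big
  (fun f : {ffun 'I_n -> 'I_x} => preim_partition f [set: 'I_n]%SET)
  (fun Q => finset.partition Q [set: 'I_n]%SET)) /=; last first.
  by move=> f _; exact: preim_partitionP.
under [RHS]eq_bigr => Q PQ.
  rewrite sum1dep_card card_ffun_preim_partition // card_ord; over.
have cardQ (Q : {set {set 'I_n}}) :
    finset.partition Q [set: 'I_n]%SET -> (#|Q| < n.+1)%N.
  by move=> /card_partition_leq; rewrite cardsT card_ord.
rewrite (partition_big
  (fun Q : {set {set 'I_n}} => inord #|Q| : 'I_n.+1) xpredT) //=.
apply: eq_bigr => m _.
rewrite /stirling2 -sum1dep_card big_distrl /=; apply: eq_big => Q.
  case PQ : (finset.partition Q _) => //=.
  by rewrite -val_eqE /= inordK // cardQ.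
by move=> /andP[PQ /eqP <-]; rewrite mul1n.
Qed.

Lemma stirling2_small n m : (n < m)%N -> stirling2 n m = 0%N.
Proof.
move=> nm; apply/eqP; rewrite cards_eq0; apply/eqP/setP => Q.
rewrite !inE; apply/negbTE/negP => /andP[/card_partition_leq + /eqP Qm].
by rewrite cardsT card_ord Qm leqNgt nm.
Qed.

Lemma sum_stirling2_base n x :
  (\sum_(m < x.+1) stirling2 n m * x ^_ m = x ^ n)%N.
Proof.
pose F m := (stirling2 n m * x ^_ m)%N; rewrite -sum_stirling2.
case: (leqP n x) => nx.
  rewrite (@big_ord_trim_ge _ _ _ n.+1 _ F) // => m /andP[nm _].
  by rewrite /F stirling2_small.
rewrite [RHS](@big_ord_trim_ge _ _ _ x.+1 _ F) => [//||m /andP[xm _]].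
  exact: ltnW.
by rewrite /F ffact_small ?muln0.
Qed.

Lemma fact_stirling2_le n k : (k`! * stirling2 n k <= k ^ n)%N.
Proof.
by rewrite -sum_stirling2_base big_ord_recr /= ffactnn mulnC leq_addl.
Qed.

Lemma fact_stirling2_ge n k :
  (k.+1 ^ n <= k.+1`! * stirling2 n k.+1 + k.+1 * k ^ n)%N.
Proof.
rewrite -sum_stirling2_base big_ord_recr /= ffactnn mulnC addnC leq_add2l.
rewrite -[in leqRHS]sum_stirling2_base big_distrr /=; apply: leq_sum => m _.
rewrite mulnCA leq_mul2l; apply/orP; right.
case: m => -[|l] /= lk; first by rewrite !ffactn0 muln1.
by rewrite ffactSS leq_mul2l /= ffactnSr leq_pmulr // subn_gt0.
Qed.

Section rstirling2_theory.
Variables (R : realType) (r : R).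
Hypothesis r_ge0 : 0 <= r.
Implicit Types n k : nat.

Lemma rstirling2E n k : rstirling2 n k r =
  \sum_(j < n.+1) 'C(n, j)%:R * (stirling2 j k)%:R * r ^+ (n - j).
Proof.
by apply: big_nat_trim_lt => j jk; rewrite stirling2_small // mulr0 mul0r.
Qed.

Lemma exprD_natl n k : (k%:R + r) ^+ n =
  \sum_(j < n.+1) 'C(n, j)%:R * (k ^ j)%:R * r ^+ (n - j).
Proof.
rewrite addrC exprDn; apply: eq_bigr => j _.
by rewrite natrX -mulr_natl; ring.
Qed.

Lemma rstirling2_ge0 n k : 0 <= rstirling2 n k r.
Proof.
by rewrite rstirling2E; apply: sumr_ge0 => j _; rewrite !mulr_ge0 // exprn_ge0.
Qed.

Lemma rstirling2n0 n : rstirling2 n 0 r = r ^+ n.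
Proof.
have stirling2n0 j : stirling2 j 0 = (0 ^ j)%N.
  by rewrite -sum_stirling2_base big_ord_recl big_ord0 ffactn0 muln1 addn0.
rewrite rstirling2E -[in RHS](add0r r) (exprD_natl n 0).
by under eq_bigr do rewrite stirling2n0.
Qed.

Lemma fact_rstirling2_le n k : k`!%:R * rstirling2 n k r <= (k%:R + r) ^+ n.
Proof.
rewrite rstirling2E exprD_natl mulr_sumr; apply: ler_sum => j _.
rewrite mulrA ler_wpM2r ?exprn_ge0 // mulrCA ler_wpM2l //.
by rewrite -natrM ler_nat fact_stirling2_le.
Qed.

Lemma fact_rstirling2_ge n k :
  (k%:R + r) ^+ n - k%:R * (k%:R + r - 1) ^+ n <= k`!%:R * rstirling2 n k r.
Proof.
case: k => [|k]; first by rewrite mul0r subr0 add0r rstirling2n0 mul1r.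
have -> : k.+1%:R + r - 1 = k%:R + r by rewrite -natr1; ring.
rewrite lerBlDr rstirling2E !exprD_natl !mulr_sumr -big_split /=.
apply: ler_sum => j _; rewrite !mulrA -mulrDl ler_wpM2r ?exprn_ge0 //.
rewrite ![_ * 'C(n, j)%:R]mulrC -!mulrA -mulrDr ler_wpM2l //.
by rewrite -!natrM -natrD ler_nat fact_stirling2_ge.
Qed.

Definition rstirling2_quot k n : R :=
  k`!%:R * rstirling2 n k r / (k%:R + r) ^+ n.

Lemma rstirling2_ratioE k i j : 0 < k%:R + r ->
  rstirling2 i k r / rstirling2 j k r
    = rstirling2_quot k i / rstirling2_quot k j
      * ((k%:R + r) ^+ i / (k%:R + r) ^+ j).
Proof.
move=> c_gt0; rewrite /rstirling2_quot.
have [->|stirling_neq0] := eqVneq (rstirling2 j k r) 0.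
  by rewrite !(mulr0, mul0r, invr0).
have fact_neq0 : k`!%:R != 0 :> R by rewrite pnatr_eq0 -lt0n fact_gt0.
by field; rewrite stirling_neq0 fact_neq0 !expf_neq0 ?gt_eqF.
Qed.

Lemma rstirling2_quot_itv k n : 0 < k%:R + r -> 0 <= rstirling2_quot k n <= 1.
Proof.
move=> c_gt0; have cn_gt0 : 0 < (k%:R + r) ^+ n by rewrite exprn_gt0.
rewrite ler_pdivrMr // mul1r fact_rstirling2_le andbT.
by rewrite divr_ge0 ?mulr_ge0 ?rstirling2_ge0 ?ltW.
Qed.

Lemma rstirling2_ratio_itv k i j : 0 < k%:R + r ->
  0 <= rstirling2 i k r / rstirling2 j k r
    <= (rstirling2_quot k j)^-1 * ((k%:R + r) ^+ i / (k%:R + r) ^+ j).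
Proof.
move=> c_gt0; have /andP[qi_ge0 qi_le1] := rstirling2_quot_itv i c_gt0.
have /andP[qj_ge0 _] := rstirling2_quot_itv j c_gt0.
have cX_ge0 : 0 <= (k%:R + r) ^+ i / (k%:R + r) ^+ j.
  by rewrite divr_ge0 ?exprn_ge0 ?ltW.
rewrite divr_ge0 ?rstirling2_ge0 //= rstirling2_ratioE // ler_wpM2r //.
by rewrite ler_piMl ?invr_ge0.
Qed.

Lemma cvg_rstirling2_quot k : 0 < k%:R + r ->
  rstirling2_quot k n @[n --> \oo] --> (1 : R).
Proof.
set c := k%:R + r => c_gt0.
apply: (@squeeze_cvgr _ _ _ _ (fun n => 1 - k%:R * ((c - 1) / c) ^+ n) (cst 1)).
- near=> n; have cn_gt0 : 0 < c ^+ n by rewrite exprn_gt0.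
  have /andP[_ ->] := rstirling2_quot_itv n c_gt0; rewrite andbT ler_pdivlMr //.
  by rewrite mulrBl mul1r -mulrA -exprMn divfK ?gt_eqF // fact_rstirling2_ge.
- rewrite -[X in _ --> X]subr0; apply: cvgB; first exact: cvg_cst.
  case: (posnP k) => [->|k_gt0].
    by under eq_fun do rewrite mul0r; exact: cvg_cst.
  rewrite -(mulr0 k%:R); apply: cvgM; first exact: cvg_cst.
  have k_ge1 : 1 <= k%:R :> R by rewrite ler1n.
  apply: cvg_expr; rewrite ger0_norm ?ltr_pdivrMr ?mul1r ?gtrBl //.
  by rewrite divr_ge0 ?(ltW c_gt0) // /c; move: r_ge0; lra.
- exact: cvg_cst.
Unshelve. all: by end_near. Qed.

End rstirling2_theory.

(** * The Gamma function *)

Lemma gt0_shift1_ind (R : archiRealFieldType) (P : R -> Prop) :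
    (forall z, 0 < z <= 1 -> P z) ->
    (forall z, 0 < z -> P z -> P (z + 1)) ->
  forall z, 0 < z -> P z.
Proof.
move=> P01 PS z z_gt0.
have [m zm] : exists m, z <= m.+1%:R.
  by exists (Num.truncn z); rewrite ltW // truncnS_gt.
elim: m z z_gt0 zm => [|m IH] z z_gt0 zm; first by apply: P01; rewrite z_gt0.
case: (lerP z 1) => z1; first by apply: P01; rewrite z_gt0.
rewrite -(subrK 1 z); apply: PS; first by rewrite subr_gt0.
by apply: IH; rewrite ?subr_gt0 // lerBlDr natr1.
Qed.

Section real_limits.
Variable R : realType.
Implicit Types (t z : R).

Lemma cvgn_natrV : n%:R^-1 @[n --> \oo] --> (0 : R).
Proof.
apply/gtr0_cvgV0; last exact: cvgr_idn.
by near=> n; rewrite ltr0n; near: n; exact: nbhs_infty_gt.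
Unshelve. all: by end_near. Qed.

Lemma cvgn_shift_div_natr z : (z + n%:R) / n%:R @[n --> \oo] --> (1 : R).
Proof.
rewrite -[X in _ --> X]add0r -(mulr0 z).
apply: (@near_eq_cvg_to _ _ _ _ (fun n => z * n%:R^-1 + 1)).
  near=> n; rewrite mulrDl divff // pnatr_eq0 -lt0n.
  by near: n; exact: nbhs_infty_gt.
apply: cvgD; last exact: cvg_cst.
by apply: cvgM; [exact: cvg_cst|exact: cvgn_natrV].
Unshelve. all: by end_near. Qed.

Lemma cvgry_ln : ln t @[t --> +oo] --> (+oo : set_system R).
Proof.
apply/cvgryPge => A; near=> t.
have At : expR A < t by near: t; exact: nbhs_pinfty_gt.
by rewrite -(expRK A) ler_ln ?posrE ?expR_gt0 ?(lt_trans (expR_gt0 A)) ?ltW.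
Unshelve. all: by end_near. Qed.

Lemma cvgny_ratio (J : nat -> nat) (u : nat -> R) z : 0 < z ->
  u n @[n --> \oo] --> +oo -> (J n)%:R / u n @[n --> \oo] --> z ->
  J n @[n --> \oo] --> \oo.
Proof.
move=> z_gt0 u_infty Ju; apply/(@cvgrnyP R)/cvgryPge => A; near=> n.
have u_gt0 : 0 < u n by near: n; exact: (cvgry_gt u_infty).
have : z / 2 <= (J n)%:R / u n by near: n; apply: (cvgr_ge _ Ju); lra.
rewrite ler_pdivlMr //; apply: le_trans.
rewrite mulrC -ler_pdivrMr ?divr_gt0 //.
by near: n; exact: (cvgry_ge u_infty).
Unshelve. all: by end_near. Qed.

Lemma continuous_powR z t : 0 < t -> {for t, continuous (@powR R ^~ z)}.
Proof.
move=> t_gt0; apply: differentiable_continuous; apply/derivable1_diffP.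
by apply: derivable_powR; rewrite in_itv /= andbT.
Qed.

Lemma continuous_expRN : continuous (fun t => expR (- t)).
Proof.
move=> t; apply: (@continuous_comp _ _ _ -%R expR); first exact: opp_continuous.
exact: continuous_expR.
Qed.

Lemma is_derive_oppr_expRN t :
  is_derive t 1 (fun s => - expR (- s)) (expR (- t)).
Proof. by apply: is_derive_eq; rewrite /GRing.scale /=; ring. Qed.

Lemma gt0_powRE t z : 0 < t -> t `^ z = expR (z * ln t).
Proof. by move=> t_gt0; rewrite /powR gt_eqF. Qed.

Lemma powRB1_mulr t z : 0 < t -> t `^ z = t `^ (z - 1) * t.
Proof.
move=> t_gt0; rewrite -[X in _ * X]powRr1 ?ltW // -powRD ?subrK //.
by rewrite (gt_eqF t_gt0) implybT.
Qed.

Lemma gt0_powRD t z w : 0 < t -> t `^ (z + w) = t `^ z * t `^ w.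
Proof. by move=> t_gt0; rewrite powRD // (gt_eqF t_gt0) implybT. Qed.

(* [z ln (t / 2z) <= t / 2], so the powers are absorbed by half of the
   exponential. *)
Lemma cvgry_powR_expRN z : 0 < z ->
  t `^ z * expR (- t) @[t --> +oo] --> (0 : R).
Proof.
move=> z_gt0; set w := 2 * z; have w_gt0 : 0 < w by rewrite mulr_gt0.
apply: (@squeeze_cvgr _ _ _ _ (cst 0) (fun t => w `^ z * expR (- (t / 2)))).
- near=> t; have t_gt0 : 0 < t by near: t; exact: nbhs_pinfty_gt.
  have q_gt0 : 0 < t / w by rewrite divr_gt0.
  rewrite mulr_ge0 ?powR_ge0 ?expR_ge0 //=.
  rewrite -[in t `^ z](divfK (lt0r_neq0 w_gt0) t).
  rewrite powRM ?(ltW q_gt0) ?(ltW w_gt0) // mulrAC [leRHS]mulrC.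
  rewrite ler_wpM2r ?powR_ge0 // gt0_powRE // -expRD ler_expR.
  have := ler_wpM2l (ltW z_gt0) (ltW (ln_sublinear q_gt0)).
  have -> : z * (t / w) = t / 2 by rewrite /w; field; rewrite gt_eqF.
  by lra.
- exact: cvg_cst.
- rewrite -(mulr0 (w `^ z)); apply: cvgM; first exact: cvg_cst.
  apply: (@cvg_comp _ _ _ ( *%R^~ 2^-1) (fun y => expR (- y)) _ +oo).
    by apply: gt0_cvgMly; [rewrite invr_gt0|exact: cvg_id].
  exact: cvgr_expR.
Unshelve. all: by end_near. Qed.

Lemma cvg_at_right_powR_expRN z : 0 < z ->
  t `^ z * expR (- t) @[t --> 0^'+] --> (0 : R).
Proof.
move=> z_gt0; rewrite -[X in _ --> X](mul0r (expR (- 0))).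
apply: cvgM; first exact: powR_cvg0.
exact/cvg_at_right_filter/continuous_expRN.
Qed.

Lemma powR_AGM z t s : 0 < z -> 0 < t -> 0 <= s <= 1 ->
  z `^ (1 - s) * t `^ s <= (1 - s) * z + s * t.
Proof.
move=> z_gt0 t_gt0 /andP[s_ge0 s_le1].
have := convex_expR (Itv01 s_ge0 s_le1) (ln t) (ln z).
rewrite !convRE /= /unstable.onem !lnK ?posrE // expRD -!gt0_powRE //.
by rewrite [leLHS]mulrC [leRHS]addrC.
Qed.

Lemma bigcup_itvVcc (u : nat -> R) :
  (forall n, 0 < u n) -> u n @[n --> \oo] --> +oo ->
  \bigcup_n `[(u n)^-1, u n]%classic = `]0, +oo[%classic :> set R.
Proof.
move=> u_gt0 u_infty; apply/seteqP; split => t /=; rewrite in_itv /= andbT.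
  move=> [n _] /=; rewrite in_itv /= => /andP[+ _]; apply: lt_le_trans.
  by rewrite invr_gt0.
move=> t_gt0; have tV_gt0 : 0 < t^-1 by rewrite invr_gt0.
have [m tm] := filter_ex (cvgry_ge u_infty (t + t^-1)).
exists m => //=; rewrite in_itv /=; apply/andP; split; last by lra.
by rewrite -[leRHS]invrK lef_pV2 ?posrE //; lra.
Qed.

Lemma cvg_integral_itvVcc (f : R -> R) (u : nat -> R) :
  nondecreasing_seq u -> (forall n, 0 < u n) -> u n @[n --> \oo] --> +oo ->
  measurable_fun `](0 : R), +oo[ f -> (forall t, 0 < t -> 0 <= f t) ->
  (\int[lebesgue_measure]_(t in `[((u n)^-1)%R, u n]) (f t)%:E @[n --> \oo] -->
   \int[lebesgue_measure]_(t in `]0%R, +oo[) (f t)%:E)%E.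
Proof.
move=> u_nd u_gt0 u_infty mf f_ge0.
have sub n : `[(u n)^-1, u n]%classic `<=` `]0, +oo[%classic.
  by rewrite -(bigcup_itvVcc u_gt0 u_infty) => t ?; exists n.
rewrite -(bigcup_itvVcc u_gt0 u_infty).
apply: ge0_nondecreasing_set_cvg_integral.
- move=> m n mn; rewrite subsetEset; apply: subset_itv; rewrite bnd_simp.
    by rewrite lef_pV2 ?posrE // u_nd.
  exact: u_nd.
- by move=> n; exact: measurable_itv.
- move=> n; apply/measurable_EFinP; apply: (measurable_funS _ (@sub n) mf).
  exact: measurable_itv.
- move=> n t /sub /=; rewrite in_itv /= andbT => t_gt0.
  by rewrite lee_fin f_ge0.
Qed.

End real_limits.

Section Gamma_function.
Variable R : realType.
Implicit Types (z s t : R).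
Notation mu := (@lebesgue_measure R).

Definition gamma_integrand z t : R := t `^ (z - 1) * expR (- t).

Definition eGamma z : \bar R :=
  (\int[mu]_(t in `]0%R, +oo[) (gamma_integrand z t)%:E)%E.

Lemma GammaE z : Gamma z = fine (eGamma z).
Proof. by []. Qed.

Lemma gamma_integrand_ge0 z t : 0 <= gamma_integrand z t.
Proof. by rewrite mulr_ge0 ?powR_ge0 ?expR_ge0. Qed.

Lemma measurable_gamma_integrand z D : measurable_fun D (gamma_integrand z).
Proof.
apply: measurable_funTS; apply: measurable_funM; first exact: measurable_powR.
exact: measurableT_comp.
Qed.

Lemma continuous_gamma_integrand z t :
  0 < t -> {for t, continuous (gamma_integrand z)}.
Proof.
move=> t_gt0.
by apply: cvgM; [exact: continuous_powR|exact: continuous_expRN].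
Qed.

Lemma gamma_integrandD1 z t : 0 < t ->
  gamma_integrand (z + 1) t = gamma_integrand z t * t.
Proof.
by move=> t_gt0; rewrite /gamma_integrand addrK (powRB1_mulr z) // mulrAC.
Qed.

Lemma integral_gamma_integrandZ z a (D : set R) : measurable D -> 0 <= a ->
  (\int[mu]_(t in D) (a * gamma_integrand z t)%:E
   = a%:E * \int[mu]_(t in D) (gamma_integrand z t)%:E)%E.
Proof.
move=> mD a_ge0; under eq_integral do rewrite EFinM.
rewrite ge0_integralZl_EFin // => [t _|].
  by rewrite lee_fin gamma_integrand_ge0.
by apply/measurable_EFinP; exact: measurable_gamma_integrand.
Qed.

Lemma integral_gamma_by_parts z a b : 0 < z -> 0 < a < b ->
  (\int[mu]_(t in `[a, b]) (gamma_integrand (z + 1) t)%:E =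
   (a `^ z * expR (- a) - b `^ z * expR (- b))%:E
   + z%:E * \int[mu]_(t in `[a, b]) (gamma_integrand z t)%:E)%E.
Proof.
move=> z_gt0 /andP[a_gt0 ab].
have gt0_cc t : t \in `[a, b] -> 0 < t.
  by rewrite in_itv /= => /andP[+ _]; exact: lt_le_trans.
have gt0_oo t : t \in `]a, b[ -> 0 < t by move=> /subset_itv_oo_cc/gt0_cc.
rewrite /gamma_integrand addrK (integration_by_parts (F := @powR R ^~ z)
  (G := fun t => - expR (- t)) (f := fun t => z * t `^ (z - 1))
  (g := fun t => expR (- t))) //.
- congr (_ + _)%E; first by congr EFin; ring.
  rewrite -integral_gamma_integrandZ ?ltW // -[RHS]oppeK -[in RHS]integral_ge0N.
    by congr (- _)%E; apply: eq_integral => t _; rewrite -EFinN mulrN mulrA.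
  by move=> t _; rewrite lee_fin mulr_ge0 ?gamma_integrand_ge0 // ltW.
- apply: continuous_in_subspaceT => t /set_mem/gt0_cc t_gt0.
  by apply: cvgM; [exact: cvg_cst|exact: continuous_powR].
- split.
  + by move=> t /gt0_oo t_gt0; apply: derivable_powR; rewrite in_itv /= andbT.
  + exact/cvg_at_right_filter/continuous_powR.
  + exact/cvg_at_left_filter/continuous_powR/(lt_trans a_gt0).
- by move=> t /gt0_oo t_gt0; apply: powR_derive1; rewrite in_itv /= andbT.
- exact/continuous_subspaceT/continuous_expRN.
- split; first by move=> t _; have [] := is_derive_oppr_expRN t.
  + by apply/cvg_at_right_filter; apply: cvgN; exact: continuous_expRN.
  + by apply/cvg_at_left_filter; apply: cvgN; exact: continuous_expRN.
- move=> t _; rewrite derive1E.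
  exact: (@derive_val _ _ _ _ _ _ _ (is_derive_oppr_expRN t)).
Qed.

Lemma eGammaD1 z : 0 < z -> eGamma (z + 1) = (z%:E * eGamma z)%E.
Proof.
move=> z_gt0; pose u n : R := n.+2%:R.
have u_gt1 n : 1 < u n by rewrite ltr1n.
have u_gt0 n : 0 < u n by exact: lt_trans (u_gt1 n).
have uV_lt n : 0 < (u n)^-1 < u n.
  by rewrite invr_gt0 u_gt0 (lt_trans _ (u_gt1 n)) // invf_lt1.
have u_nd : nondecreasing_seq u by move=> m n mn; rewrite ler_nat !ltnS.
have u_infty : u n @[n --> \oo] --> +oo.
  have := @cvgr_idn R; rewrite -(cvg_shiftn 2).
  by apply: cvg_trans; apply: near_eq_cvg; near=> n; rewrite /= addn2.
have uV_cvg0 : (u n)^-1 @[n --> \oo] --> 0 by apply/gtr0_cvgV0 => //; near=> n.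
have exhaust w := cvg_integral_itvVcc u_nd u_gt0 u_infty
  (@measurable_gamma_integrand w _) (fun t _ => gamma_integrand_ge0 w t).
pose boundary t := t `^ z * expR (- t).
have boundary_cvg0 :
    (boundary (u n)^-1 - boundary (u n))%:E @[n --> \oo] --> 0%E.
  apply: cvg_EFin; first by near=> n.
  rewrite -(subrr 0); apply: cvgB.
    have /cvg_at_rightP := cvg_at_right_powR_expRN z_gt0; apply.
    by split => // n; rewrite invr_gt0.
  exact: cvg_comp u_infty (cvgry_powR_expRN z_gt0).
apply: (cvg_unique _ (exhaust (z + 1))) => //.
rewrite /=; under eq_fun do rewrite (integral_gamma_by_parts z_gt0 (uV_lt _)).
rewrite -[(z%:E * _)%E]add0e; apply: cvgeD boundary_cvg0 _.
  by rewrite fin_num_adde_defr.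
exact/cvgeZl.
Unshelve. all: by end_near. Qed.

Lemma eGamma_ge0 z : (0 <= eGamma z)%E.
Proof. by apply: integral_ge0 => t _; rewrite lee_fin gamma_integrand_ge0. Qed.

Lemma eGamma1 : eGamma 1 = 1%:E.
Proof.
rewrite /eGamma /gamma_integrand subrr.
under eq_integral => t _ do rewrite powRr0 mul1r.
rewrite integral_itv_obnd_cbnd; last first.
  apply/measurable_EFinP/measurable_funTS.
  exact: measurableT_comp.
rewrite (@ge0_continuous_FTC2y _ _ (fun t => - expR (- t)) _ 0).
- by rewrite oppr0 expR0 EFinN oppeK add0e.
- by move=> t _; exact: expR_ge0.
- exact/continuous_subspaceT/continuous_expRN.
- by rewrite -[X in _ --> X]oppr0; apply: cvgN; exact: cvgr_expR.
- by move=> t _; have [] := is_derive_oppr_expRN t.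
- by apply/cvg_at_right_filter; apply: cvgN; exact: continuous_expRN.
- move=> t _; rewrite derive1E.
  exact: (@derive_val _ _ _ _ _ _ _ (is_derive_oppr_expRN t)).
Qed.

Lemma gamma_integrand_AGM z s t : 0 < z -> 0 <= s <= 1 -> 0 < t ->
  z `^ (1 - s) * gamma_integrand (z + s) t
    <= (1 - s) * z * gamma_integrand z t + s * gamma_integrand (z + 1) t.
Proof.
move=> z_gt0 s01 t_gt0.
have -> : gamma_integrand (z + s) t = gamma_integrand z t * t `^ s.
  by rewrite /gamma_integrand addrAC (gt0_powRD _ s t_gt0) mulrAC.
rewrite gamma_integrandD1 //.
have := ler_wpM2l (gamma_integrand_ge0 z t) (powR_AGM z_gt0 t_gt0 s01).
by lra.
Qed.

Lemma eGamma_wendel_le z s : 0 < z -> 0 <= s <= 1 ->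
  ((z `^ (1 - s))%:E * eGamma (z + s)%R <= z%:E * eGamma z)%E.
Proof.
move=> z_gt0 /[dup] s01 /andP[s_ge0 s_le1].
have sC_ge0 : 0 <= 1 - s by rewrite subr_ge0.
have mZ a w : measurable_fun `](0 : R), +oo[ (fun t => a * gamma_integrand w t).
  by apply: measurable_funM => //; exact: measurable_gamma_integrand.
rewrite /eGamma -integral_gamma_integrandZ ?powR_ge0 //.
apply: (@le_trans _ _ (\int[mu]_(t in `]0%R, +oo[)
    ((1 - s) * z * gamma_integrand z t + s * gamma_integrand (z + 1) t)%:E)%E).
  apply: ge0_le_integral => //=.
  - by move=> t _; rewrite lee_fin mulr_ge0 ?powR_ge0 ?gamma_integrand_ge0.
  - by apply/measurable_EFinP; exact: mZ.
  - by apply/measurable_EFinP; apply: measurable_funD; exact: mZ.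
  - move=> t; rewrite in_itv /= andbT => t_gt0.
    by rewrite lee_fin gamma_integrand_AGM.
under eq_integral do rewrite EFinD.
rewrite ge0_integralD //=; last 4 first.
- move=> t _; rewrite lee_fin.
  by rewrite mulr_ge0 ?gamma_integrand_ge0 ?mulr_ge0 ?(ltW z_gt0).
- by apply/measurable_EFinP; exact: mZ.
- by move=> t _; rewrite lee_fin mulr_ge0 ?gamma_integrand_ge0.
- by apply/measurable_EFinP; exact: mZ.
rewrite !integral_gamma_integrandZ ?mulr_ge0 ?(ltW z_gt0) // -!/(eGamma _).
rewrite eGammaD1 // muleA -EFinM -ge0_muleDl ?lee_fin ?mulr_ge0 ?(ltW z_gt0) //.
by rewrite -EFinD -mulrDl subrK mul1r.
Qed.

Lemma eGamma_fin_num z : 0 < z -> eGamma z \is a fin_num.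
Proof.
elim/gt0_shift1_ind => {}z => [/andP[z_gt0 z_le1]|z_gt0 zfin]; last first.
  by rewrite eGammaD1 // fin_numM.
have z01 : 0 <= z <= 1 by rewrite ltW.
have := eGamma_wendel_le ltr01 z01; rewrite powR1 !mul1e eGamma1.
rewrite addrC eGammaD1 //; have := eGamma_ge0 z.
by case: (eGamma z) => [g| |] //= _; rewrite gt0_muley ?lte_fin.
Qed.

Lemma EFin_Gamma z : 0 < z -> (Gamma z)%:E = eGamma z.
Proof. by move=> z_gt0; rewrite GammaE fineK // eGamma_fin_num. Qed.

Lemma GammaD1 z : 0 < z -> Gamma (z + 1) = z * Gamma z.
Proof.
by move=> z_gt0; rewrite !GammaE eGammaD1 // fineM // eGamma_fin_num.
Qed.

Lemma Gamma1 : Gamma (1 : R) = 1.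
Proof. by rewrite GammaE eGamma1. Qed.

Lemma Gamma_wendel_le z s : 0 < z -> 0 <= s <= 1 ->
  z `^ (1 - s) * Gamma (z + s) <= z * Gamma z.
Proof.
move=> z_gt0 s01; have zs_gt0 : 0 < z + s by case/andP: s01; lra.
have := eGamma_wendel_le z_gt0 s01.
by rewrite -(EFin_Gamma z_gt0) -(EFin_Gamma zs_gt0) -!EFinM lee_fin.
Qed.

Lemma Gamma_natS n : Gamma n.+1%:R = n`!%:R :> R.
Proof.
elim: n => [|n IH]; first by rewrite Gamma1.
by rewrite -natr1 GammaD1 // IH factS natrM.
Qed.

Lemma GammaDn z n : 0 < z ->
  Gamma (z + n%:R) = \prod_(i < n) (z + i%:R) * Gamma z.
Proof.
move=> z_gt0; elim: n => [|n IH]; first by rewrite addr0 big_ord0 mul1r.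
by rewrite -natr1 addrA GammaD1 ?IH ?big_ord_recr /= ?ltr_wpDr //; ring.
Qed.

Lemma Gamma_gt0 z : 0 < z -> 0 < Gamma z.
Proof.
elim/gt0_shift1_ind => {}z => [/andP[z_gt0 z_le1]|z_gt0 Gz_gt0]; last first.
  by rewrite GammaD1 // mulr_gt0.
have : 0 <= 1 - z <= 1 by rewrite subr_ge0 z_le1 gerBl ltW.
move=> /(Gamma_wendel_le z_gt0).
rewrite addrCA subrr addr0 Gamma1 mulr1 => le_Gz.
by rewrite -(pmulr_rgt0 _ z_gt0) (lt_le_trans _ le_Gz) // powR_gt0.
Qed.

Lemma natr_fact_gt0 n : 0 < n`!%:R :> R.
Proof. by rewrite ltr0n fact_gt0. Qed.

Definition gauss_norm z (n : nat) : R := n`!%:R * n%:R `^ (z - 1).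

Definition gauss_quot z (n : nat) : R :=
  (\prod_(i < n) (z + i%:R)) / gauss_norm z n.

Lemma gauss_norm_gt0 z n : (0 < n)%N -> 0 < gauss_norm z n.
Proof. by move=> n_gt0; rewrite mulr_gt0 ?natr_fact_gt0 // powR_gt0 ?ltr0n. Qed.

Lemma gauss_normD z w n : (0 < n)%N ->
  gauss_norm (z + w) n = gauss_norm z n * n%:R `^ w.
Proof.
by move=> n_gt0; rewrite /gauss_norm addrAC (gt0_powRD (z - 1)) ?mulrA ?ltr0n.
Qed.

Lemma natr_Gamma n : (0 < n)%N -> n%:R * Gamma n%:R = n`!%:R :> R.
Proof. by move=> n_gt0; rewrite -GammaD1 ?ltr0n // natr1 Gamma_natS. Qed.

Lemma GammaDn_le z n : (0 < n)%N -> 0 <= z <= 1 ->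
  Gamma (n%:R + z) <= gauss_norm z n.
Proof.
move=> n_gt0 z01; have nR_gt0 : 0 < n%:R :> R by rewrite ltr0n.
have := Gamma_wendel_le nR_gt0 z01; rewrite natr_Gamma // -opprB powRN mulrC.
by rewrite ler_pdivrMr // powR_gt0.
Qed.

Lemma GammaDn_ge z n : (0 < n)%N -> 0 <= z <= 1 ->
  gauss_norm z n * n%:R <= Gamma (n%:R + z) * (n%:R + z).
Proof.
move=> n_gt0 /andP[z_ge0 z_le1]; have nR_gt0 : 0 < n%:R :> R by rewrite ltr0n.
have nz_gt0 : 0 < n%:R + z by rewrite ltr_wpDr.
have zC01 : 0 <= 1 - z <= 1 by rewrite subr_ge0 z_le1 gerBl.
rewrite -mulrA -powRB1_mulr //.
apply: (@le_trans _ _ (n`!%:R * (n%:R + z) `^ z)).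
  rewrite ler_wpM2l // ge0_ler_powR // ?nnegrE ?lerDl //.
  exact: ltW nz_gt0.
have -> : n`!%:R = Gamma (n%:R + z + (1 - z)) :> R.
  by rewrite -Gamma_natS -natr1; congr Gamma; ring.
by have := Gamma_wendel_le nz_gt0 zC01; rewrite subKr mulrC [leRHS]mulrC.
Qed.

Lemma gauss_quot_itv z n : (0 < n)%N -> 0 < z <= 1 ->
  ((z + n%:R) / n%:R)^-1 <= Gamma z * gauss_quot z n <= 1.
Proof.
move=> n_gt0 /andP[z_gt0 z_le1]; have z01 : 0 <= z <= 1 by rewrite ltW.
have norm_gt0 := gauss_norm_gt0 z n_gt0.
have -> : Gamma z * gauss_quot z n = Gamma (n%:R + z) / gauss_norm z n.
  by rewrite [n%:R + z]addrC GammaDn // mulrA [Gamma z * _]mulrC.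
rewrite ler_pdivrMr // mul1r GammaDn_le // andbT ler_pdivlMr // invf_div mulrAC.
rewrite [z + _]addrC ler_pdivrMr ?ltr_wpDl // [_ * gauss_norm _ _]mulrC.
exact: GammaDn_ge.
Qed.

Lemma gauss_quotD1 z n : 0 < z -> (0 < n)%N ->
  gauss_quot (z + 1) n = gauss_quot z n * ((z + n%:R) / n%:R) / z.
Proof.
move=> z_gt0 n_gt0; have nR_gt0 : 0 < n%:R :> R by rewrite ltr0n.
apply: (mulfI (lt0r_neq0 z_gt0)).
rewrite /gauss_quot [LHS]mulrA prod_addn_shift gauss_normD // powRr1 ?ltW //.
by field; rewrite !gt_eqF ?gauss_norm_gt0.
Qed.

Lemma cvg_gauss_quot z : 0 < z -> gauss_quot z n @[n --> \oo] --> (Gamma z)^-1.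
Proof.
elim/gt0_shift1_ind => {}z => [/[dup] z01 /andP[z_gt0 _]|z_gt0 IH]; last first.
  rewrite GammaD1 // invfM mulrC -[(Gamma z)^-1]mulr1.
  apply: near_eq_cvg_to
    (cvgM (cvgM IH (cvgn_shift_div_natr z)) (cvg_cst z^-1)); near=> n => /=.
  by rewrite gauss_quotD1 //; near: n; exact: nbhs_infty_gt.
have Gz_gt0 := Gamma_gt0 z_gt0.
suff Gz_quot_cvg : Gamma z * gauss_quot z n @[n --> \oo] --> (1 : R).
  rewrite -[X in _ --> X]mulr1.
  apply: near_eq_cvg_to (cvgM (cvg_cst (Gamma z)^-1) Gz_quot_cvg).
  near=> n => /=.
  by rewrite mulKf ?gt_eqF.
apply: (@squeeze_cvgr _ _ _ _ (fun n => ((z + n%:R) / n%:R)^-1) (cst 1)).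
- by near=> n; apply: gauss_quot_itv z01; near: n; exact: nbhs_infty_gt.
- by rewrite -[X in _ --> X]invr1; apply: cvgV (cvgn_shift_div_natr z).
- exact: cvg_cst.
Unshelve. all: by end_near. Qed.

End Gamma_function.

(** * Stirling's formula and the Poisson distribution *)

Section Stirling_formula.
Variable R : realType.
Implicit Types (a b t : R).
Notation mu := (@lebesgue_measure R).

Lemma integral_gamma_half_gauss a b : 0 < a -> a <= b ->
  (\int[mu]_(t in `[(a ^+ 2)%R, (b ^+ 2)%R]) (gamma_integrand 2^-1 t)%:E
   = \int[mu]_(t in `[a, b]) (2 * gauss_fun t)%:E)%E.
Proof.
move=> a_gt0 ab.
have is_derive_sqr t : is_derive t 1 (fun s : R => s ^+ 2) (2 * t).
  by apply: is_derive_eq; rewrite /GRing.scale /=; ring.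
have derive1_sqr : (fun s : R => s ^+ 2)^`()%classic = *%R 2.
  apply/funext => t; rewrite derive1E.
  exact: (@derive_val _ _ _ _ _ _ _ (is_derive_sqr t)).
have cvg_double t : 2 * s @[s --> t] --> 2 * t.
  by apply: cvgM; [exact: cvg_cst|exact: cvg_id].
rewrite (@integration_by_substitution_increasing _ (fun t => t ^+ 2)) //;
  rewrite ?derive1_sqr.
- apply: eq_integral => t /set_mem /=; rewrite in_itv /= => /andP[a_le_t _].
  have t_gt0 : 0 < t by exact: lt_le_trans a_le_t.
  congr EFin; rewrite fctE /= /gamma_integrand /gauss_fun.
  have -> : (t ^+ 2) `^ (2^-1 - 1) = t^-1.
    rewrite -powR_mulrn ?(ltW t_gt0) // -powRrM -[RHS]powR_inv1 ?(ltW t_gt0) //.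
    by congr powR; field.
  by field; rewrite gt_eqF.
- move=> s t; rewrite !in_itv /= => /andP[a_le_s _] /andP[a_le_t _] st.
  by rewrite ltr_pXn2r // nnegrE ltW // (lt_le_trans a_gt0).
- by move=> t _; exact: cvg_double.
- exact/cvgP/cvg_at_right_filter/cvg_double.
- exact/cvgP/cvg_at_left_filter/cvg_double.
- split.
  + by move=> t _; have [] := is_derive_sqr t.
  + exact/cvg_at_right_filter/exprn_continuous.
  + exact/cvg_at_left_filter/exprn_continuous.
- apply: continuous_in_subspaceT => t /set_mem /=; rewrite in_itv /=.
  move=> /andP[a2_le_t _]; apply: continuous_gamma_integrand.
  by rewrite (lt_le_trans _ a2_le_t) ?exprn_gt0.
Qed.

Lemma Gamma_half : Gamma (2^-1 : R) = Num.sqrt pi.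
Proof.
pose u n : R := n.+1%:R.
have u_gt0 n : 0 < u n by rewrite ltr0n.
have u_ge1 n : 1 <= u n by rewrite ler1n.
have u_nd : nondecreasing_seq u by move=> m n mn; rewrite ler_nat ltnS.
have u_infty : u n @[n --> \oo] --> +oo.
  by have := @cvgr_idn R; rewrite -cvg_shiftS.
have sqr_nd : nondecreasing_seq (fun n => u n ^+ 2).
  by move=> m n mn; rewrite lerXn2r ?nnegrE ?(ltW (u_gt0 _)) // u_nd.
have sqr_infty : u n ^+ 2 @[n --> \oo] --> +oo.
  exact: cvg_comp u_infty cvgr_expr2.
have mgauss : measurable_fun `](0 : R), +oo[ (fun t => 2 * gauss_fun t).
  apply: measurable_funTS; apply: measurable_funM; first exact: measurable_cst.
  exact: measurable_gauss_fun.
have cvg_gamma := cvg_integral_itvVcc sqr_nd (fun n => exprn_gt0 2 (u_gt0 n))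
  sqr_infty (@measurable_gamma_integrand R 2^-1 _)
  (fun t _ => gamma_integrand_ge0 2^-1 t).
have cvg_gauss := cvg_integral_itvVcc u_nd u_gt0 u_infty mgauss
  (fun t _ => mulr_ge0 (ler0n _ 2) (gauss_fun_ge0 t)).
have gamma_gauss n : (\int[mu]_(t in `[((u n ^+ 2)^-1)%R, (u n ^+ 2)%R])
      (gamma_integrand 2^-1 t)%:E
    = \int[mu]_(t in `[((u n)^-1)%R, u n]) (2 * gauss_fun t)%:E)%E.
  rewrite -exprVn integral_gamma_half_gauss ?invr_gt0 //.
  by rewrite (@le_trans _ _ 1) // invf_le1.
move: cvg_gamma; under eq_fun do rewrite gamma_gauss.
move=> cvg_gamma; rewrite GammaE /eGamma (cvg_unique _ cvg_gamma cvg_gauss) //.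
under eq_integral do rewrite EFinM.
rewrite ge0_integralZl_EFin //; last 2 first.
- by move=> t _; rewrite lee_fin gauss_fun_ge0.
- by apply/measurable_EFinP/measurable_funTS; exact: measurable_gauss_fun.
rewrite integral_itv_obnd_cbnd; last first.
  by apply/measurable_EFinP/measurable_funTS; exact: measurable_gauss_fun.
by rewrite integral0y_gauss -EFinM /= mulrC divfK.
Qed.

Lemma is_derive_ge0_le (f f' : R -> R) a b : a <= b ->
  (forall t, a <= t -> is_derive t 1 f (f' t)) ->
  (forall t, a <= t -> 0 <= f' t) -> f a <= f b.
Proof.
move=> ab df f'_ge0; apply: (@ger0_derive1_ndecr _ f a b) => //.
- by move=> t; rewrite in_itv /= => /andP[/ltW /df []].
- move=> t; rewrite in_itv /= => /andP[/ltW a_le_t _].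
  rewrite derive1E (@derive_val _ _ _ _ _ _ _ (df _ a_le_t)).
  exact: f'_ge0.
- apply: continuous_in_subspaceT => t /set_mem /=; rewrite in_itv /=.
  move=> /andP[/df[dt _] _].
  by apply: differentiable_continuous; apply/derivable1_diffP.
Qed.

Lemma ln_ge_pade t : 1 <= t -> 2 * (t - 1) / (t + 1) <= ln t.
Proof.
move=> t_ge1; rewrite -subr_ge0.
have -> : 0 = ln 1 - 2 * (1 - 1) / (1 + 1) :> R by rewrite ln1; field.
apply: (@is_derive_ge0_le (fun t => ln t - 2 * (t - 1) / (t + 1))
   (fun t => (t - 1) ^+ 2 / (t * (t + 1) ^+ 2))) => // s s_ge1.
  have s_gt0 : 0 < s by lra.
  have s1_neq0 : s + 1 != 0 by rewrite gt_eqF //; lra.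
  have dln := is_derive1_ln s_gt0.
  apply: is_derive_eq.
  by rewrite /GRing.scale /=; field; rewrite s1_neq0 gt_eqF.
by rewrite divr_ge0 ?sqr_ge0 // mulr_ge0 ?sqr_ge0 //; lra.
Qed.

Lemma ln_le_trapezoid t : 1 <= t -> ln t <= (t - t^-1) / 2.
Proof.
move=> t_ge1; rewrite -subr_ge0.
have -> : 0 = (1 - 1^-1) / 2 - ln 1 :> R by rewrite ln1; field.
apply: (@is_derive_ge0_le (fun t => (t - t^-1) / 2 - ln t)
   (fun t => (1 - t^-1) ^+ 2 / 2)) => // s s_ge1; last first.
  by rewrite divr_ge0 ?sqr_ge0.
have s_gt0 : 0 < s by lra.
have s_neq0 : s != 0 by rewrite gt_eqF.
have dln := is_derive1_ln s_gt0.
have dV : is_derive s 1 (fun y : R => y^-1) (- s ^- 2 *: 1).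
  exact: (@is_deriveV _ id).
by apply: is_derive_eq; rewrite /GRing.scale /=; field; rewrite gt_eqF.
Qed.

Definition stirling_quot (n : nat) : R :=
  n`!%:R / (Num.sqrt n%:R * n%:R ^+ n * expR (- n%:R)).

Definition ln_stirling_quot (n : nat) : R :=
  ln n`!%:R + n%:R - (n%:R + 2^-1) * ln n%:R.

Lemma stirling_quot_expR n : (0 < n)%N ->
  stirling_quot n = expR (ln_stirling_quot n).
Proof.
move=> n_gt0; have nR_gt0 : 0 < n%:R :> R by rewrite ltr0n.
rewrite expRB expRD lnK ?posrE ?natr_fact_gt0 // mulrDl expRD.
rewrite expRM_natl lnK ?posrE // -gt0_powRE // powR12_sqrt ?(ltW nR_gt0) //.
rewrite /stirling_quot expRN; field.
by rewrite !gt_eqF ?sqrtr_gt0 ?exprn_gt0 ?expR_gt0.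
Qed.

Lemma ln_stirling_quot_step n : (0 < n)%N ->
  0 <= ln_stirling_quot n - ln_stirling_quot n.+1 <= (n%:R^-1 - n.+1%:R^-1) / 4.
Proof.
move=> n_gt0; pose x : R := n%:R; have x_gt0 : 0 < x by rewrite ltr0n.
have -> : n.+1%:R = x + 1 :> R by rewrite natr1.
have -> : ln_stirling_quot n - ln_stirling_quot n.+1
    = (x + 2^-1) * ln (1 + x^-1) - 1.
  have -> : 1 + x^-1 = n.+1%:R / x by rewrite -natr1 -/x; field; rewrite gt_eqF.
  rewrite /ln_stirling_quot ln_div ?posrE ?ltr0n // factS natrM.
  by rewrite lnM ?posrE ?ltr0n ?fact_gt0 // -natr1 -/x; ring.
rewrite -/x; have xV_gt0 : 0 < x^-1 by rewrite invr_gt0.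
have y_ge1 : 1 <= 1 + x^-1 by lra.
have xh_ge0 : 0 <= x + 2^-1 by lra.
have lower := ler_wpM2l xh_ge0 (ln_ge_pade y_ge1).
have upper := ler_wpM2l xh_ge0 (ln_le_trapezoid y_ge1).
have lowerE : (x + 2^-1) * (2 * (1 + x^-1 - 1) / (1 + x^-1 + 1)) = 1.
  by field; rewrite !gt_eqF //=; lra.
have upperE : (x + 2^-1) * ((1 + x^-1 - (1 + x^-1)^-1) / 2)
    = 1 + (x^-1 - (x + 1)^-1) / 4.
  by field; rewrite !gt_eqF //=; lra.
by rewrite lowerE in lower; rewrite upperE in upper; lra.
Qed.

Lemma is_cvg_stirling_quot :
  exists2 D : R, 0 < D & stirling_quot n @[n --> \oo] --> D.
Proof.
pose l n := ln_stirling_quot n.+1.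
have step n : 0 <= l n - l n.+1 <= (n.+1%:R^-1 - n.+2%:R^-1) / 4.
  exact: ln_stirling_quot_step.
have l_noninc : nonincreasing_seq l.
  by apply/nonincreasing_seqP => n; rewrite -subr_ge0; case/andP: (step n).
have l_lb n : l 0 - 4^-1 + n.+1%:R^-1 / 4 <= l n.
  elim: n => [|n IH]; first by rewrite invr1 mul1r subrK.
  have /andP[_] := step n; move: IH.
  by move: (l 0) (l n) (l n.+1) (n.+1%:R^-1) (n.+2%:R^-1) => *; lra.
have l_cvg : cvgn l.
  apply: nonincreasing_is_cvgn => //; exists (l 0 - 4^-1) => _ [n _ <-].
  by apply: le_trans (l_lb n); rewrite lerDl mulr_ge0.
exists (expR (limn l)); first exact: expR_gt0.
rewrite -cvg_shiftS /=; under eq_fun do rewrite stirling_quot_expR //.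
exact: cvg_comp l_cvg (@continuous_expR _ _).
Qed.

Lemma prod_half_fact n :
  \prod_(i < n) (2^-1 + i%:R) * (4 ^+ n * n`!%:R) = n.*2`!%:R :> R.
Proof.
elim: n => [|n IH]; first by rewrite big_ord0 !mul1r.
rewrite doubleS !factS !natrM -IH big_ord_recr /= exprS.
have -> : n.*2.+2%:R = 2 * (n%:R + 1) :> R.
  by rewrite -addn2 natrD -mul2n natrM; ring.
have -> : n.*2.+1%:R = 2 * (2^-1 + n%:R) :> R.
  by rewrite -addn1 natrD -mul2n natrM; field.
by rewrite -natr1; ring.
Qed.

Lemma stirling_quot_double n : (0 < n)%N ->
  stirling_quot n.*2 / (stirling_quot n * stirling_quot n)
    = gauss_quot 2^-1 n / Num.sqrt 2.
Proof.
move=> n_gt0; have nR_gt0 : 0 < n%:R :> R by rewrite ltr0n.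
rewrite /gauss_quot /gauss_norm /stirling_quot -prod_half_fact.
have -> : n%:R `^ (2^-1 - 1) = (Num.sqrt n%:R)^-1 :> R.
  by rewrite -powR12_sqrt ?(ltW nR_gt0) // -powRN; congr powR; field.
have -> : n.*2%:R = 2 * n%:R :> R by rewrite -mul2n natrM.
rewrite sqrtrM // -addnn exprMn !exprD !expRN mulr_natl mulr2n expRD.
have -> : 4 ^+ n = 2 ^+ n * 2 ^+ n :> R.
  by rewrite -exprMn; congr (_ ^+ _); ring.
by field; rewrite !gt_eqF ?sqrtr_gt0 ?addr_gt0 ?exprn_gt0 ?expR_gt0.
Qed.

(* The limit is read off the Gauss product of [Gamma (1 / 2)], in which
   [prod_half_fact] leaves only factorials. *)
Lemma cvg_stirling_quot : stirling_quot n @[n --> \oo] --> Num.sqrt (2 * pi).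
Proof.
have [D D_gt0 cvg_D] := is_cvg_stirling_quot.
suff -> : Num.sqrt (2 * pi) = D by [].
have half_gt0 : 0 < 2^-1 :> R by rewrite invr_gt0.
have double_infty : double n @[n --> \oo] --> \oo.
  apply/cvgnyPge => A; near=> n.
  rewrite -addnn (leq_trans _ (leq_addr _ _)) //.
  by near: n; exact: nbhs_infty_ge.
have cvg_quot : gauss_quot 2^-1 n / Num.sqrt 2 @[n --> \oo] --> D / (D * D).
  apply: (@near_eq_cvg_to _ _ _ _
    (fun n => stirling_quot n.*2 / (stirling_quot n * stirling_quot n))).
    near=> n; apply: stirling_quot_double.
    by near: n; exact: nbhs_infty_gt.
  apply: cvgM; first exact: cvg_comp double_infty cvg_D.
  by apply: cvgV; [rewrite mulf_neq0 // gt_eqF|exact: cvgM].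
have cvg_gauss : gauss_quot 2^-1 n / Num.sqrt 2 @[n --> \oo]
    --> (Gamma (2^-1 : R))^-1 / Num.sqrt 2.
  by apply: cvgM; [exact: cvg_gauss_quot|exact: cvg_cst].
have : D / (D * D) = (Gamma (2^-1 : R))^-1 / Num.sqrt 2.
  exact: cvg_unique cvg_quot cvg_gauss.
rewrite Gamma_half invfM mulVKf ?gt_eqF // -invfM => /invr_inj ->.
by rewrite sqrtrM // mulrC.
Unshelve. all: by end_near. Qed.

End Stirling_formula.

Section poisson_asymptotics.
Variable R : realType.
Implicit Types (rate y : R) (j : nat).

Lemma poisson_pmfE rate j :
  0 < rate -> poisson_pmf rate j = rate ^+ j / j`!%:R * expR (- rate).
Proof. by rewrite /poisson_pmf => ->. Qed.

Lemma poisson_pmf_stirling rate y j :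
  0 < rate -> 0 < y -> j%:R = y * rate ->
  poisson_pmf rate j = expR (- (rate * (y * ln y - y + 1)))
    / (stirling_quot R j * Num.sqrt (y * rate)).
Proof.
move=> rate_gt0 y_gt0 jE; have jR_gt0 : 0 < j%:R :> R by rewrite jE mulr_gt0.
rewrite poisson_pmfE // /stirling_quot -jE.
have -> : expR (- (rate * (y * ln y - y + 1)))
    = expR (- rate) * expR j%:R / y ^+ j.
  rewrite -[in y ^+ j](lnK y_gt0) -expRM_natl -expRD -expRB jE.
  by congr expR; ring.
have -> : j%:R ^+ j = y ^+ j * rate ^+ j by rewrite [in LHS]jE exprMn.
rewrite [expR (- j%:R)]expRN; field.
by rewrite !gt_eqF ?sqrtr_gt0 ?exprn_gt0 ?expR_gt0 ?natr_fact_gt0.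
Qed.

Lemma asymp_equiv_poisson_pmf (rate y_ : nat -> R) (J : nat -> nat) y :
  0 < y -> y_ n @[n --> \oo] --> y -> rate n @[n --> \oo] --> +oo ->
  (\forall n \near \oo, (J n)%:R = y_ n * rate n) ->
  asymp_equiv (fun n => poisson_pmf (rate n) (J n))
    (fun n => expR (- (rate n * (y_ n * ln (y_ n) - y_ n + 1)))
       / Num.sqrt (2 * pi * y * rate n)).
Proof.
move=> y_gt0 y_cvg rate_infty JE.
have J_infty : J n @[n --> \oo] --> \oo.
  apply: (cvgny_ratio y_gt0 rate_infty); apply: near_eq_cvg_to y_cvg.
  near=> n; rewrite (_ : (J n)%:R = y_ n * rate n); last by near: n.
  by rewrite mulfK // gt_eqF //; near: n; exact: (cvgry_gt rate_infty).
have sqrt2pi_gt0 : 0 < Num.sqrt (2 * pi) :> R.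
  by rewrite sqrtr_gt0 mulr_gt0 ?pi_gt0.
have sq_cvg : stirling_quot R (J n) @[n --> \oo] --> Num.sqrt (2 * pi).
  exact: cvg_comp J_infty (@cvg_stirling_quot R).
have quot_cvg : Num.sqrt (2 * pi) / stirling_quot R (J n)
    * Num.sqrt (y / y_ n) @[n --> \oo] --> (1 : R).
  rewrite [X in _ --> X](_ : _ = Num.sqrt (2 * pi) / Num.sqrt (2 * pi)
    * Num.sqrt (y / y)); last by rewrite !divff ?sqrtr1 ?mulr1 ?lt0r_neq0.
  apply: cvgM.
    apply: cvgM; first exact: cvg_cst.
    by apply: cvgV => //; exact: lt0r_neq0.
  apply: continuous_cvg; first exact: sqrt_continuous.
  apply: cvgM; first exact: cvg_cst.
  by apply: cvgV => //; exact: lt0r_neq0.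
apply: near_eq_cvg_to quot_cvg; near=> n.
have yn_gt0 : 0 < y_ n by near: n; exact: (cvgr_gt _ y_cvg).
have rate_gt0 : 0 < rate n by near: n; exact: (cvgry_gt rate_infty).
have sq_gt0 : 0 < stirling_quot R (J n).
  by near: n; exact: (cvgr_gt _ sq_cvg).
rewrite (poisson_pmf_stirling rate_gt0 yn_gt0); last by near: n.
have -> : Num.sqrt (2 * pi * y * rate n)
    = Num.sqrt (2 * pi) * (Num.sqrt (y / y_ n) * Num.sqrt (y_ n * rate n)).
  rewrite -sqrtrM ?divr_ge0 ?(ltW y_gt0) ?(ltW yn_gt0) //.
  rewrite -sqrtrM ?mulr_ge0 ?pi_ge0 //; congr Num.sqrt.
  by field; rewrite gt_eqF.
have exp_gt0 := expR_gt0 (- (rate n * (y_ n * ln (y_ n) - y_ n + 1))).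
have sqrt_rate_gt0 : 0 < Num.sqrt (y_ n * rate n) by rewrite sqrtr_gt0 mulr_gt0.
have sqrt_quot_gt0 : 0 < Num.sqrt (y / y_ n) by rewrite sqrtr_gt0 divr_gt0.
by field; rewrite !gt_eqF.
Unshelve. all: by end_near. Qed.

End poisson_asymptotics.

(** * Truncated power series *)

Section truncated_power_series.
Variable R : realType.
Implicit Types (p q s : {poly R}) (a b rho : R) (M : nat).

Definition trunc_norm rho M p : R := \sum_(i < M.+1) `|p`_i| * rho ^+ i.

Definition trunc_eq M p q := forall i, (i <= M)%N -> p`_i = q`_i.

Lemma trunc_eq_refl M p : trunc_eq M p p.
Proof. by []. Qed.

Lemma trunc_eq_sym M p q : trunc_eq M p q -> trunc_eq M q p.
Proof. by move=> pq i iM; rewrite pq. Qed.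

Lemma trunc_eq_trans M p q s :
  trunc_eq M p q -> trunc_eq M q s -> trunc_eq M p s.
Proof. by move=> pq qs i iM; rewrite pq // qs. Qed.

Lemma trunc_eqM M p p' q q' :
  trunc_eq M p p' -> trunc_eq M q q' -> trunc_eq M (p * q) (p' * q').
Proof.
move=> pp qq i iM; rewrite !coefM; apply: eq_bigr => k _.
have ki : (k <= i)%N by rewrite -ltnS.
by rewrite pp ?qq // (leq_trans _ iM) // leq_subr.
Qed.

Lemma trunc_norm_eq rho M p q :
  trunc_eq M p q -> trunc_norm rho M p = trunc_norm rho M q.
Proof. by move=> pq; apply: eq_bigr => i _; rewrite pq // -ltnS. Qed.

Lemma trunc_norm_ge0 rho M p : 0 <= rho -> 0 <= trunc_norm rho M p.
Proof.
by move=> rho_ge0; apply: sumr_ge0 => i _; rewrite mulr_ge0 ?exprn_ge0.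
Qed.

Lemma trunc_normC rho M a : trunc_norm rho M a%:P = `|a|.
Proof.
rewrite /trunc_norm big_ord_recl /= coefC eqxx mulr1 big1 ?addr0 // => i _.
by rewrite coefC /= normr0 mul0r.
Qed.

Lemma trunc_normXaddC rho M a : 0 <= rho ->
  trunc_norm rho M ('X + a%:P) <= rho + `|a|.
Proof.
move=> rho_ge0; rewrite /trunc_norm big_ord_recl /= coefD coefX coefC /=.
rewrite add0r mulr1 addrC lerD2r; case: M => [|M]; first by rewrite big_ord0.
rewrite big_ord_recl big1 ?addr0 => [|i _]; rewrite coefD coefX coefC /= addr0.
  by rewrite normr1 mul1r expr1.
by rewrite normr0 mul0r.
Qed.

(* Passing to absolute values, the truncated product is part of a full one. *)
Lemma trunc_normM rho M p q : 0 <= rho ->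
  trunc_norm rho M (p * q) <= trunc_norm rho M p * trunc_norm rho M q.
Proof.
move=> rho_ge0.
pose absp s : {poly R} := \poly_(i < M.+1) `|s`_i|.
have absp_ge0 s i : 0 <= (absp s)`_i by rewrite coef_poly; case: ifP.
have trunc_norm_horner s : trunc_norm rho M s = (absp s).[rho].
  rewrite (@horner_coef_wide _ M.+1) ?size_poly //; apply: eq_bigr => i _.
  by rewrite coef_poly ltn_ord.
rewrite [X in _ <= X * _]trunc_norm_horner [X in _ <= _ * X]trunc_norm_horner.
rewrite -hornerM.
rewrite [leRHS](@horner_coef_wide _ (M.+1 + size (absp p * absp q)));
  last exact: leq_addl.
rewrite big_split_ord /= -[leLHS]addr0; apply: lerD; last first.
  apply: sumr_ge0 => i _; rewrite mulr_ge0 ?exprn_ge0 // coefM.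
  by apply: sumr_ge0 => k _; rewrite mulr_ge0.
apply: ler_sum => i _; rewrite ler_wpM2r ?exprn_ge0 // !coefM.
apply: le_trans (ler_norm_sum _ _ _) _; apply: ler_sum => k _.
have iM := ltn_ord i; have ki := ltn_ord k.
by rewrite normrM !coef_poly (leq_trans ki) // (leq_ltn_trans (leq_subr _ _)).
Qed.

Lemma trunc_norm_prod rho M (I : Type) (r : seq I) (F : I -> {poly R}) :
  0 <= rho ->
  trunc_norm rho M (\prod_(i <- r) F i)
    <= \prod_(i <- r) trunc_norm rho M (F i).
Proof.
move=> rho_ge0; elim: r => [|i r IH].
  by rewrite !big_nil trunc_normC normr1.
rewrite !big_cons; apply: le_trans (trunc_normM _ _ _ rho_ge0) _.
by rewrite ler_wpM2l ?trunc_norm_ge0.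
Qed.

Definition exp_poly M a : {poly R} := \poly_(i < M.+1) (a ^+ i / i`!%:R).

Lemma exp_poly0 M : trunc_eq M (exp_poly M 0) 1.
Proof.
move=> i iM; rewrite coef_poly ltnS iM coef1.
by case: i {iM} => [|i]; rewrite ?expr0 ?divr1 // expr0n mul0r.
Qed.

Lemma exp_polyD M a b :
  trunc_eq M (exp_poly M a * exp_poly M b) (exp_poly M (a + b)).
Proof.
move=> m mM; rewrite coefM coef_poly ltnS mM addrC exprDn mulr_suml.
apply: eq_bigr => i _; have im := ltn_ord i.
rewrite !coef_poly (leq_trans im) // ltnS (leq_trans (leq_subr _ _)) //.
rewrite -mulr_natl -(bin_fact (ltnSE im)) !natrM.
have bin_neq0 : 'C(m, i)%:R != 0 :> R by rewrite pnatr_eq0 -lt0n bin_gt0.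
by field; rewrite bin_neq0 !gt_eqF ?natr_fact_gt0.
Qed.

Lemma exp_poly_sum M (I : Type) (r : seq I) (F : I -> R) :
  trunc_eq M (\prod_(i <- r) exp_poly M (F i)) (exp_poly M (\sum_(i <- r) F i)).
Proof.
elim: r => [|i r IH]; first by rewrite !big_nil => i iM; rewrite exp_poly0.
rewrite !big_cons; apply: trunc_eq_trans (exp_polyD _ _).
exact: trunc_eqM.
Qed.

Lemma sum_exp_coeff_le a n : 0 <= a -> \sum_(i < n) a ^+ i / i`!%:R <= expR a.
Proof.
move=> a_ge0; rewrite -(big_mkord xpredT (exp_coeff a)).
apply: (@nondecreasing_cvgn_le _ (series (exp_coeff a))).
  by apply: nondecreasing_series => k _ _; exact: exp_coeff_ge0.
exact: is_cvg_series_exp_coeff.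
Qed.

Lemma trunc_norm_exp_poly rho M a : 0 <= rho ->
  trunc_norm rho M (exp_poly M a) <= expR (`|a| * rho).
Proof.
move=> rho_ge0.
apply: le_trans (sum_exp_coeff_le M.+1 _); last by rewrite mulr_ge0.
apply: ler_sum => i _; rewrite coef_poly ltn_ord normrM normfV normrX.
by rewrite (ger0_norm (ler0n _ _)) exprMn mulrAC.
Qed.

(* The coefficients of the power series [p(v) * exp (a v)]. *)
Definition mul_exp_coef p a (m : nat) : R :=
  \sum_(i < m.+1) p`_i * (a ^+ (m - i) / (m - i)`!%:R).

Lemma mul_exp_coefE M p a m : (m <= M)%N ->
  (p * exp_poly M a)`_m = mul_exp_coef p a m.
Proof.
move=> mM; rewrite coefM; apply: eq_bigr => i _.
by rewrite coef_poly ltnS (leq_trans (leq_subr _ _)).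
Qed.

Lemma mul_exp_coefMXaddC0 p c a : mul_exp_coef (p * 'X + c%:P) a 0 = c.
Proof.
rewrite /mul_exp_coef big_ord1 coefD coefMX coefC /= add0r.
by rewrite expr0 fact0 divr1 mulr1.
Qed.

Lemma mul_exp_coefMXaddCS p c a m :
  mul_exp_coef (p * 'X + c%:P) a m.+1
    = mul_exp_coef p a m + c * (a ^+ m.+1 / m.+1`!%:R).
Proof.
rewrite /mul_exp_coef big_ord_recl addrC; congr (_ + _).
  apply: eq_bigr => i _; rewrite lift0 subSS coefD coefMX coefC /=.
  by rewrite addr0.
by rewrite subn0 coefD coefMX coefC /= add0r.
Qed.

Lemma cvg_sum_mul_exp_coef p a v :
  \sum_(m < M) mul_exp_coef p a m * v ^+ m @[M --> \oo]
    --> p.[v] * expR (a * v).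
Proof.
elim/poly_ind: p => [|p c IH].
  rewrite horner0 mul0r; apply: near_eq_cvg_to (cvg_cst 0); near=> M.
  rewrite big1 // => m _; rewrite /mul_exp_coef big1 ?mul0r // => i _.
  by rewrite coef0 mul0r.
rewrite -cvg_shiftS /=.
have partial_sumE M :
    \sum_(m < M.+1) mul_exp_coef (p * 'X + c%:P) a m * v ^+ m =
      (\sum_(m < M) mul_exp_coef p a m * v ^+ m) * v
      + c * series (exp_coeff (a * v)) M.+1.
  rewrite /series /= big_mkord !big_ord_recl /= mul_exp_coefMXaddC0 mulr1.
  rewrite /exp_coeff /= expr0 fact0 divr1 mulrDr mulr1 addrCA; congr (_ + _).
  rewrite mulr_suml mulr_sumr -big_split; apply: eq_bigr => m _ /=.
  by rewrite /bump add1n mul_exp_coefMXaddCS exprMn (exprS v); ring.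
under eq_fun do rewrite partial_sumE.
rewrite hornerMXaddC mulrDl mulrAC; apply: cvgD.
  by apply: cvgM; [exact: IH|exact: cvg_cst].
apply: cvgM; first exact: cvg_cst.
by have := @is_cvg_series_exp_coeff R (a * v); rewrite cvg_shiftS.
Unshelve. all: by end_near. Qed.

End truncated_power_series.

(** * The Weierstrass product of the rising factorial *)

Section weierstrass_product.
Variables (R : realType) (r : R).
Hypothesis r_ge0 : 0 <= r.
Implicit Types (rho y : R) (n m M : nat).

Definition euler_gap n : R := \sum_(i < n) harmonic i - ln n.+1%:R.

Lemma euler_gap_itv n : 0 <= euler_gap n <= 1 - n.+1%:R^-1.
Proof.
elim: n => [|n]; first by rewrite /euler_gap big_ord0 ln1 invr1 !subrr lexx.
rewrite /euler_gap big_ord_recr /=; set S := \sum_(i < n) _.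
pose x : R := n.+1%:R; have x_gt0 : 0 < x by rewrite ltr0n.
have -> : n.+2%:R = x + 1 :> R by rewrite natr1.
have -> : ln (x + 1) = ln x + ln (1 + x^-1).
  by rewrite -lnM ?posrE ?addr_gt0 ?invr_gt0 // mulrDr mulr1 divff ?gt_eqF.
have upper : ln (1 + x^-1) <= x^-1.
  by apply: le_ln1Dx; rewrite (lt_trans _ (_ : 0 < _)) ?invr_gt0 // oppr_lt0.
have lower : (x + 1)^-1 <= ln (1 + x^-1).
  have -> : 1 + x^-1 = (1 + - (x + 1)^-1)^-1 by field; rewrite !gt_eqF //; lra.
  have xV_lt1 : (x + 1)^-1 < 1 by rewrite invf_lt1; lra.
  by rewrite lnV ?posrE ?subr_gt0 // lerNr; apply: le_ln1Dx; rewrite ltrN2.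
have : 0 < (x + 1)^-1 by rewrite invr_gt0; lra.
rewrite -/x; move: (ln x) (ln (1 + x^-1)) (x^-1) ((x + 1)^-1) upper lower.
by move=> *; lra.
Qed.

Lemma sum_harmonic_sqr_le n : \sum_(i < n) harmonic i ^+ 2 <= 2 :> R.
Proof.
suff : \sum_(i < n) harmonic i ^+ 2 <= 2 - 2 * n.+1%:R^-1 :> R.
  by move=> /le_trans; apply; rewrite lerBlDr lerDl mulr_ge0.
elim: n => [|n IH]; first by rewrite big_ord0 invr1 mulr1 subrr.
rewrite big_ord_recr /=.
have -> : n.+2%:R = n.+1%:R + 1 :> R by rewrite natr1.
have x_ge1 : 1 <= n.+1%:R :> R by rewrite ler1n.
move: (n.+1%:R) x_ge1 IH => x x_ge1 IH.
suff : x^-1 ^+ 2 <= 2 * x^-1 - 2 * (x + 1)^-1 by lra.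
have -> : 2 * x^-1 - 2 * (x + 1)^-1 = 2 / (x * (x + 1)).
  by field; rewrite !gt_eqF //; lra.
rewrite ler_pdivlMr; last by rewrite mulr_gt0; lra.
have -> : x^-1 ^+ 2 * (x * (x + 1)) = 1 + x^-1.
  by field; rewrite !gt_eqF //; lra.
have : x^-1 <= 1 by rewrite invf_le1; lra.
by lra.
Qed.

(* The truncation of [(1 + w y) e^(- w y)] at [w = 'X + r]. *)
Definition weierstrass_factor M y : {poly R} :=
  (expR (- (r * y)))%:P * ((y%:P * 'X + (1 + r * y)%:P) * exp_poly M (- y)).

Lemma weierstrass_factorE M y : weierstrass_factor M y = (expR (- (r * y)))%:P *
  (y%:P * (exp_poly M (- y) * 'X) + (1 + r * y)%:P * exp_poly M (- y)).
Proof. by rewrite /weierstrass_factor; ring. Qed.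

Lemma coef0_weierstrass_factor M y :
  (weierstrass_factor M y)`_0 = expR (- (r * y)) * (1 + r * y).
Proof.
rewrite weierstrass_factorE coefCM coefD !coefCM coefMX /= mulr0 add0r.
by rewrite coef_poly /= expr0 divr1 mulr1.
Qed.

Lemma coefS_weierstrass_factor M y i : (i < M)%N ->
  (weierstrass_factor M y)`_i.+1 = expR (- (r * y))
    * (y * (- y) ^+ i * (1 - (1 + r * y) / i.+1%:R)) / i`!%:R.
Proof.
move=> iM; rewrite weierstrass_factorE coefCM coefD !coefCM coefMX /=.
rewrite !coef_poly !ltnS iM (ltnW iM) exprS factS natrM; field.
by rewrite !gt_eqF ?natr_fact_gt0 // ltr_wpDr.
Qed.

Lemma norm_coefS_weierstrass_factor M y i : (i < M)%N -> 0 <= y <= 1 ->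
  `|(weierstrass_factor M y)`_i.+1| <= (2 + r) * y ^+ 2 / i`!%:R.
Proof.
move=> iM /andP[y_ge0 y_le1]; rewrite coefS_weierstrass_factor //.
rewrite normrM normfV (ger0_norm (ler0n _ _)) ler_wpM2r ?invr_ge0 //.
have exp_le1 : expR (- (r * y)) <= 1 by rewrite expR_le1 oppr_le0 mulr_ge0.
rewrite !normrM (ger0_norm (expR_ge0 _)) (ger0_norm y_ge0) normrX normrN.
rewrite (ger0_norm y_ge0) -[leRHS]mul1r; apply: ler_pM => //.
  by rewrite !mulr_ge0 ?exprn_ge0.
rewrite [leRHS]mulrC expr2 -!mulrA ler_wpM2l //.
case: i {iM} => [|i].
  rewrite expr0 mul1r divr1 opprD addNKr normrN ger0_norm ?mulr_ge0 //.
  by rewrite [r * y]mulrC ler_wpM2l // lerDr.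
have iV_le1 : i.+2%:R^-1 <= 1 :> R by rewrite invf_le1 ?ler1n ?ltr0n.
apply: ler_pM; rewrite ?exprn_ge0 //.
  by rewrite exprS ler_piMr ?exprn_ile1.
apply: le_trans (ler_normB _ _) _; rewrite normr1 -addrA lerD2l.
have ry_le : r * y <= r by rewrite ler_piMr.
rewrite ger0_norm ?mulr_ge0 ?addr_ge0 ?mulr_ge0 //.
by apply: le_trans (ler_piMr _ iV_le1) _; rewrite ?addr_ge0 ?mulr_ge0 // lerD2l.
Qed.

Lemma trunc_norm_weierstrass_factor rho M y : 0 <= rho -> 0 <= y <= 1 ->
  trunc_norm rho M (weierstrass_factor M y)
    <= expR ((2 + r) * rho * expR rho * y ^+ 2).
Proof.
move=> rho_ge0 /[dup] y01 /andP[y_ge0 y_le1].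
apply: le_trans (expR_ge1Dx _).
rewrite /trunc_norm big_ord_recl /= mulr1; apply: lerD.
  rewrite coef0_weierstrass_factor ger0_norm; last first.
    by rewrite mulr_ge0 ?expR_ge0 ?addr_ge0 ?mulr_ge0.
  by rewrite expRN mulrC ler_pdivrMr ?expR_gt0 // mul1r expR_ge1Dx.
apply: (@le_trans _ _
    ((2 + r) * rho * y ^+ 2 * \sum_(i < M) rho ^+ i / i`!%:R)).
  rewrite mulr_sumr; apply: ler_sum => i _; rewrite /bump add1n exprS.
  have := ler_wpM2r (mulr_ge0 rho_ge0 (exprn_ge0 i rho_ge0))
    (norm_coefS_weierstrass_factor (ltn_ord i) y01).
  by move=> /le_trans; apply; rewrite le_eqVlt; apply/predU1P; left; ring.
rewrite [leRHS]mulrAC ler_wpM2l ?sum_exp_coeff_le //.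
by rewrite !mulr_ge0 ?addr_ge0.
Qed.

Lemma prod_weierstrass_factor M n :
  trunc_eq M (\prod_(i < n) weierstrass_factor M (harmonic i))
    ((expR (- (r * \sum_(i < n) harmonic i)) / n`!%:R)%:P
     * \prod_(i < n) ('X + (r + i.+1%:R)%:P)
     * exp_poly M (- \sum_(i < n) harmonic i)).
Proof.
have linear_factor (i : 'I_n) : (harmonic i)%:P * 'X + (1 + r * harmonic i)%:P
    = (harmonic i)%:P * ('X + (r + i.+1%:R)%:P).
  rewrite mulrDr -rmorphM /=; congr (_ + _%:P).
  by rewrite /harmonic mulrDr mulVf ?pnatr_eq0 // mulrC addrC.
have -> : \prod_(i < n) weierstrass_factor M (harmonic i)
    = (expR (- (r * \sum_(i < n) harmonic i)) / n`!%:R)%:P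
      * \prod_(i < n) ('X + (r + i.+1%:R)%:P)
      * \prod_(i < n) exp_poly M (- harmonic i).
  rewrite /weierstrass_factor !big_split /= -rmorph_prod -expR_sum sumrN.
  rewrite -mulr_sumr; under eq_bigr do rewrite linear_factor.
  have prod_harmonic : \prod_(i < n) harmonic i = n`!%:R^-1 :> R.
    by rewrite prodfV -natr_prod fact_prod big_add1 big_mkord.
  by rewrite big_split /= -rmorph_prod prod_harmonic rmorphM /= !mulrA.
apply: trunc_eqM => //; rewrite -sumrN.
exact: exp_poly_sum.
Qed.

Lemma gauss_norm_succ n : gauss_norm r n.+1 = n`!%:R * expR (r * ln n.+1%:R).
Proof.
have nR_gt0 : 0 < n.+1%:R :> R by rewrite ltr0n.
rewrite -gt0_powRE // (powRB1_mulr r nR_gt0) /gauss_norm factS natrM.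
by rewrite [n.+1%:R * _]mulrC mulrAC -mulrA.
Qed.

Lemma trunc_eq_weierstrass_product M n :
  trunc_eq M
    ((gauss_norm r n.+1)^-1%:P * (rising n.+1 r * exp_poly M (- ln n.+1%:R)))
    ((expR (r * euler_gap n))%:P * (('X + r%:P)
      * (\prod_(i < n) weierstrass_factor M (harmonic i)
         * exp_poly M (euler_gap n)))).
Proof.
pose H : R := \sum_(i < n) harmonic i; set L := ln n.+1%:R : R.
set Q := \prod_(i < n) ('X + (r + i.+1%:R)%:P).
have risingE : rising n.+1 r = ('X + r%:P) * Q.
  by rewrite /rising big_ord_recl addr0; under eq_bigr do rewrite lift0.
have normE : (gauss_norm r n.+1)^-1
    = expR (r * euler_gap n) * (expR (- (r * H)) / n`!%:R).
  rewrite gauss_norm_succ invfM mulrC mulrA -expRD -expRN /euler_gap -/H -/L.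
  by congr (expR _ / _); ring.
have -> : (gauss_norm r n.+1)^-1%:P * (rising n.+1 r * exp_poly M (- L))
    = (expR (r * euler_gap n))%:P * (('X + r%:P)
      * ((expR (- (r * H)) / n`!%:R)%:P * Q * exp_poly M (- L))).
  by rewrite risingE normE rmorphM; ring.
do 2 apply: trunc_eqM => //.
apply: trunc_eq_sym.
apply: trunc_eq_trans
  (trunc_eqM (@prod_weierstrass_factor M n) (@trunc_eq_refl _ _ _)) _.
rewrite -mulrA; apply: trunc_eqM => //.
have -> : - L = - H + euler_gap n by rewrite /euler_gap addKr.
exact: exp_polyD.
Qed.

(* The power series coefficients in [v] of [gauss_quot (v + r) n]. *)
Definition gauss_coef n m : R :=
  mul_exp_coef (rising n r) (- ln n%:R) m / gauss_norm r n.

Lemma gauss_coef_bound rho : 0 <= rho -> exists2 C : R, 0 <= C &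
  forall n M, (0 < n)%N -> \sum_(m < M) `|gauss_coef n m| * rho ^+ m <= C.
Proof.
move=> rho_ge0; pose K := (2 + r) * rho * expR rho.
have K_ge0 : 0 <= K by rewrite !mulr_ge0 ?expR_ge0 ?addr_ge0.
exists (expR r * ((rho + r) * (expR (K * 2) * expR rho))).
  by rewrite !mulr_ge0 ?expR_ge0 ?addr_ge0.
move=> [//|n] [_|M _]; first by rewrite big_ord0 !mulr_ge0 ?expR_ge0 ?addr_ge0.
have /andP[gap_ge0 gap_le1] : 0 <= euler_gap n <= 1.
  have /andP[-> /le_trans] := euler_gap_itv n; apply.
  by rewrite gerBl invr_ge0.
have -> : \sum_(m < M.+1) `|gauss_coef n.+1 m| * rho ^+ m = trunc_norm rho M
    ((gauss_norm r n.+1)^-1%:P * (rising n.+1 r * exp_poly M (- ln n.+1%:R))).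
  apply: eq_bigr => m _; rewrite coefCM mul_exp_coefE; last by rewrite -ltnS.
  by rewrite /gauss_coef [_ / _]mulrC.
rewrite (trunc_norm_eq _ (@trunc_eq_weierstrass_product _ _)).
have norm_ge0 p : 0 <= trunc_norm rho M p by exact: trunc_norm_ge0.
apply: le_trans (trunc_normM _ _ _ rho_ge0) _; apply: ler_pM => //.
  by rewrite trunc_normC ger0_norm ?expR_ge0 // ler_expR ler_piMr.
apply: le_trans (trunc_normM _ _ _ rho_ge0) _; apply: ler_pM => //.
  by have := trunc_normXaddC M r rho_ge0; rewrite (ger0_norm r_ge0).
apply: le_trans (trunc_normM _ _ _ rho_ge0) _; apply: ler_pM => //.
  apply: le_trans (trunc_norm_prod _ _ _ rho_ge0) _.
  apply: (@le_trans _ _ (\prod_(i < n) expR (K * harmonic i ^+ 2))).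
    apply: ler_prod => i _; rewrite norm_ge0 trunc_norm_weierstrass_factor //.
    by rewrite invr_ge0 ler0n invf_le1 ?ler1n ?ltr0n.
  by rewrite -expR_sum ler_expR -mulr_sumr ler_wpM2l // sum_harmonic_sqr_le.
apply: le_trans (trunc_norm_exp_poly _ _ rho_ge0) _.
by rewrite ler_expR ger0_norm // ler_piMl.
Qed.

End weierstrass_product.

(** * Asymptotics of the r-Stirling numbers of the first kind *)

Section log_scale.
Variable R : realType.
Implicit Types (J : nat -> nat) (y : R).

Definition log_scale J y := (J n)%:R / ln n%:R @[n --> \oo] --> y.

Lemma cvgn_ln : ln n%:R @[n --> \oo] --> (+oo : set_system R).
Proof. exact: cvg_comp cvgr_idn (@cvgry_ln R). Qed.

Lemma cvgn_lnV : (ln n%:R)^-1 @[n --> \oo] --> (0 : R).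
Proof.
apply/gtr0_cvgV0; last exact: cvgn_ln.
exact: (cvgry_gt cvgn_ln).
Qed.

Lemma cvgn_ln_div : ln n%:R / n%:R @[n --> \oo] --> (0 : R).
Proof.
apply: near_eq_cvg_to (cvg_comp _ _ cvgn_ln (cvgry_powR_expRN (@ltr01 R))).
near=> n; have n_gt0 : (0 < n)%N by near: n; exact: nbhs_infty_gt.
by rewrite /= powRr1 ?ln_ge0 ?ler1n // expRN lnK // posrE ltr0n.
Unshelve. all: by end_near. Qed.

Lemma log_scale_cvgny J y : 0 < y -> log_scale J y -> J n @[n --> \oo] --> \oo.
Proof. by move=> y_gt0; exact: cvgny_ratio y_gt0 cvgn_ln. Qed.

Lemma log_scale_gtn J y K :
  0 < y -> log_scale J y -> \forall n \near \oo, (K < J n)%N.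
Proof. by move=> y_gt0 /(log_scale_cvgny y_gt0) /cvgnyPgt; apply. Qed.

Lemma log_scale_addn J y K : log_scale J y -> log_scale (fun n => J n + K)%N y.
Proof.
move=> Jy; rewrite /log_scale in Jy *; rewrite -[y]addr0 -(mulr0 K%:R).
apply: near_eq_cvg_to (cvgD Jy (cvgM (cvg_cst (K%:R : R)) cvgn_lnV)).
by near=> n => /=; rewrite natrD mulrDl.
Unshelve. all: by end_near. Qed.

Lemma log_scale_subn J y K :
  0 < y -> log_scale J y -> log_scale (fun n => J n - K)%N y.
Proof.
move=> y_gt0 Jy; rewrite /log_scale in Jy *; rewrite -[y]subr0 -(mulr0 K%:R).
apply: near_eq_cvg_to (cvgB Jy (cvgM (cvg_cst (K%:R : R)) cvgn_lnV)).
near=> n => /=; rewrite natrB ?mulrBl // ltnW //.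
by near: n; exact: log_scale_gtn Jy.
Unshelve. all: by end_near. Qed.

Lemma log_scale_ltn J y K :
  log_scale J y -> \forall n \near \oo, (J n + K < n)%N.
Proof.
move=> /(log_scale_addn K) /cvgM /(_ cvgn_ln_div); rewrite mulr0 => cvg0.
near=> n; have n_gt1 : (1 < n)%N by near: n; exact: nbhs_infty_gt.
have nR_gt0 : 0 < n%:R :> R by rewrite ltr0n ltnW.
have L_gt0 : 0 < ln n%:R :> R by rewrite ln_gt0 // ltr1n.
have : (J n + K)%:R / ln n%:R * (ln n%:R / n%:R) < 1 :> R.
  by near: n; exact: (cvgr_lt _ cvg0).
by rewrite mulrA divfK ?gt_eqF // ltr_pdivrMr // mul1r ltr_nat.
Unshelve. all: by end_near. Qed.

Lemma cvg_ffact_div_ln J y m : 0 < y -> log_scale J y ->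
  (J n ^_ m)%:R / ln n%:R ^+ m @[n --> \oo] --> y ^+ m.
Proof.
move=> y_gt0 Jy; elim: m => [|m IH].
  rewrite [X in _ --> X]expr0; apply: near_eq_cvg_to (cvg_cst (1 : R)).
  by near=> n; rewrite ffactn0 expr0 divr1.
rewrite exprSr; apply: near_eq_cvg_to (cvgM IH (log_scale_subn m y_gt0 Jy)).
by near=> n => /=; rewrite ffactnSr natrM exprSr invfM mulrACA.
Unshelve. all: by end_near. Qed.

End log_scale.

Lemma ffact_leq_exp n m : (n ^_ m <= n ^ m)%N.
Proof.
by elim: m => [|m IH] //; rewrite ffactnSr expnSr leq_mul // leq_subr.
Qed.

Lemma near_le_mul_expr (R : realType) (D : nat -> nat -> R) (Y rho e : R) :
  0 <= Y < rho -> 0 < e ->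
  (\forall n \near \oo, forall m, `|D n m| <= Y ^+ m) ->
  (forall m, D n m @[n --> \oo] --> (0 : R)) ->
  \forall n \near \oo, forall m, `|D n m| <= e * rho ^+ m.
Proof.
move=> /andP[Y_ge0 Y_lt] e_gt0 D_le D_cvg.
have rho_gt0 := le_lt_trans Y_ge0 Y_lt.
have [K _ tail_le] : \forall m \near \oo, (Y / rho) ^+ m <= e.
  apply: (cvgr_le (0 : R)) => //; apply: cvg_expr.
  by rewrite ger0_norm ?divr_ge0 ?ltr_pdivrMr ?mul1r // ltW.
have head_le : \forall n \near \oo, forall i : 'I_K, `|D n i| <= e * rho ^+ i.
  apply: filter_forall => i; near do apply: ltW; have /cvgr0Pnorm_lt := D_cvg i.
  by apply; rewrite mulr_gt0 // exprn_gt0.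
near=> n => m; case: (ltnP m K) => [mK|Km].
  have head_le_n : forall i : 'I_K, `|D n i| <= e * rho ^+ i by near: n.
  exact: (head_le_n (Ordinal mK)).
have D_le_n : forall m, `|D n m| <= Y ^+ m by near: n.
apply: le_trans (D_le_n m) _; rewrite -ler_pdivrMr ?exprn_gt0 // -expr_div_n.
exact: tail_le.
Unshelve. all: by end_near. Qed.

Section rstirling1_asymptotics.
Variables (R : realType) (r : R).
Hypothesis r_ge0 : 0 <= r.

Definition rstirling1_quot n j : R :=
  rstirling1 n j r * j`!%:R / (gauss_norm r n * ln n%:R ^+ j).

(* Multiply the power series of [gauss_quot] back by [n ^ v = e ^ (v ln n)]. *)
Lemma rstirling1_gauss_coef n j : (0 < n)%N ->
  rstirling1 n j r = gauss_norm r n *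
    \sum_(m < j.+1) gauss_coef r n m * (ln n%:R ^+ (j - m) / (j - m)`!%:R).
Proof.
move=> n_gt0; have norm_gt0 := gauss_norm_gt0 r n_gt0.
have cancel_exp : trunc_eq j (rising n r * exp_poly j (- ln n%:R)
    * exp_poly j (ln n%:R)) (rising n r).
  rewrite -mulrA -[X in trunc_eq _ _ X]mulr1; apply: trunc_eqM => // i ij.
  by rewrite exp_polyD // addNr exp_poly0.
rewrite rstirling1E -cancel_exp // coefM mulr_sumr; apply: eq_bigr => m _.
rewrite mul_exp_coefE; last by rewrite -ltnS.
rewrite coef_poly ltnS leq_subr /gauss_coef.
by field; rewrite !gt_eqF ?natr_fact_gt0.
Qed.

Lemma rstirling1_quotE n j : (1 < n)%N -> rstirling1_quot n j =
  \sum_(m < j.+1) gauss_coef r n m * ((j ^_ m)%:R / ln n%:R ^+ m).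
Proof.
move=> n_gt1; have norm_gt0 := gauss_norm_gt0 r (ltnW n_gt1).
have L_gt0 : 0 < ln n%:R :> R by rewrite ln_gt0 // ltr1n.
rewrite /rstirling1_quot rstirling1_gauss_coef; last exact: ltnW.
set S := \sum_(m < _) _ * (_ / _`!%:R).
have -> : gauss_norm r n * S * j`!%:R / (gauss_norm r n * ln n%:R ^+ j)
    = S * (j`!%:R / ln n%:R ^+ j).
  by field; rewrite !gt_eqF ?exprn_gt0.
rewrite mulr_suml; apply: eq_bigr => m _.
have mj : (m <= j)%N by rewrite -ltnS.
rewrite -[in ln _ ^+ j](subnK mj) exprD -(ffact_fact mj) natrM.
by field; rewrite !gt_eqF ?exprn_gt0 ?natr_fact_gt0.
Qed.

Lemma cvg_sum_gauss_coef n v : (0 < n)%N ->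
  \sum_(m < M) gauss_coef r n m * v ^+ m @[M --> \oo] --> gauss_quot (v + r) n.
Proof.
move=> n_gt0; have nR_gt0 : 0 < n%:R :> R by rewrite ltr0n.
have -> : gauss_quot (v + r) n
    = (rising n r).[v] * expR (- ln n%:R * v) * (gauss_norm r n)^-1.
  rewrite horner_rising /gauss_quot [in gauss_norm _ _]addrC gauss_normD //.
  rewrite gt0_powRE // mulNr expRN [v * _]mulrC; field.
  by rewrite !gt_eqF ?expR_gt0 ?gauss_norm_gt0.
apply: near_eq_cvg_to (cvgM (@cvg_sum_mul_exp_coef _ _ _ _) (cvg_cst _)).
near=> M => /=; rewrite mulr_suml; apply: eq_bigr => m _.
by rewrite /gauss_coef mulrAC.
Unshelve. all: by end_near. Qed.

Lemma rstirling1_quot_dist n j v rho e C : (1 < n)%N -> 0 <= e ->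
  (forall M, \sum_(m < M) `|gauss_coef r n m| * rho ^+ m <= C) ->
  (forall m, `|(j ^_ m)%:R / ln n%:R ^+ m - v ^+ m| <= e * rho ^+ m) ->
  `|rstirling1_quot n j - gauss_quot (v + r) n| <= e * C.
Proof.
move=> n_gt1 e_ge0 coef_le ffact_le; rewrite rstirling1_quotE //.
set F := fun m => gauss_coef r n m * ((j ^_ m)%:R / ln n%:R ^+ m).
have dist_cvg : `|\sum_(m < j.+1) F m - \sum_(m < M) gauss_coef r n m * v ^+ m|
    @[M --> \oo] --> `|\sum_(m < j.+1) F m - gauss_quot (v + r) n|.
  apply: cvg_norm; apply: cvgB; first exact: cvg_cst.
  by apply: cvg_sum_gauss_coef; exact: ltnW.
apply: (cvgr_to_le dist_cvg); near=> M.
have jM : (j < M)%N by near: M; exact: nbhs_infty_gt.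
rewrite -(@big_ord_trim_ge _ _ _ j.+1 M F) // => [|m /andP[jm _]]; last first.
  by rewrite /F ffact_small // mul0r mulr0.
rewrite -sumrB; apply: le_trans (ler_norm_sum _ _ _) _.
apply: le_trans (ler_wpM2l e_ge0 (coef_le M)); rewrite mulr_sumr.
apply: ler_sum => m _; rewrite -mulrBr normrM mulrCA.
by rewrite ler_wpM2l.
Unshelve. all: by end_near. Qed.

Variables (J : nat -> nat) (y : R).
Hypotheses (y_gt0 : 0 < y) (Jy : log_scale J y).

Lemma near_ffact_div_ln_le rho e : y + 1 < rho -> 0 < e ->
  \forall n \near \oo, forall m,
    `|(J n ^_ m)%:R / ln n%:R ^+ m - y ^+ m| <= e * rho ^+ m.
Proof.
move=> y1_lt e_gt0.
have y1_itv : 0 <= y + 1 < rho by rewrite y1_lt andbT addr_ge0 // ltW.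
apply: (near_le_mul_expr y1_itv e_gt0) => [|m]; last first.
  rewrite -(subrr (y ^+ m)); apply: cvgB; last exact: cvg_cst.
  exact: cvg_ffact_div_ln.
near=> n => m; have n_gt1 : (1 < n)%N by near: n; exact: nbhs_infty_gt.
have Lm_gt0 : 0 < ln n%:R ^+ m :> R by rewrite exprn_gt0 // ln_gt0 // ltr1n.
have J_le : (J n)%:R / ln n%:R <= y + 1.
  by near: n; apply: (cvgr_le _ Jy); rewrite ltrDl.
have J_ge0 : 0 <= (J n)%:R / ln n%:R :> R.
  by rewrite divr_ge0 ?ln_ge0 ?ler1n ?(ltnW n_gt1).
have y1_ge0 : 0 <= y + 1 by case/andP: y1_itv.
have ffact_itv : 0 <= (J n ^_ m)%:R / (ln n%:R : R) ^+ m <= (y + 1) ^+ m.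
  rewrite divr_ge0 ?(ltW Lm_gt0) //=.
  apply: (@le_trans _ _ (((J n)%:R / ln n%:R) ^+ m)).
    by rewrite expr_div_n ler_pM2r ?invr_gt0 // -natrX ler_nat ffact_leq_exp.
  by rewrite lerXn2r.
have yX_itv : 0 <= y ^+ m <= (y + 1) ^+ m.
  by rewrite exprn_ge0 ?(ltW y_gt0) // lerXn2r ?nnegrE ?lerDl ?(ltW y_gt0).
by rewrite ler_norml; lra.
Unshelve. all: by end_near. Qed.

Lemma cvg_rstirling1_quot :
  rstirling1_quot n (J n) @[n --> \oo] --> (Gamma (y + r))^-1.
Proof.
pose rho := y + 2; have rho_ge0 : 0 <= rho by rewrite addr_ge0 // ltW.
have [C C_ge0 coef_le] := gauss_coef_bound r_ge0 rho_ge0.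
have yr_gt0 : 0 < y + r by rewrite ltr_wpDr.
suff dist_cvg0 :
    rstirling1_quot n (J n) - gauss_quot (y + r) n @[n --> \oo] --> 0.
  rewrite -[X in _ --> X]add0r.
  apply: near_eq_cvg_to (cvgD dist_cvg0 (cvg_gauss_quot yr_gt0)).
  by near=> n => /=; rewrite subrK.
apply/cvgr0Pnorm_le => e e_gt0.
have eC_gt0 : 0 < e / (C + 1) by rewrite divr_gt0 // ltr_wpDl.
near=> n; have n_gt1 : (1 < n)%N by near: n; exact: nbhs_infty_gt.
apply: (@le_trans _ _ (e / (C + 1) * C)).
  apply: rstirling1_quot_dist (ltW eC_gt0) _ _ => // [M|].
    exact: coef_le (ltnW n_gt1).
  by near: n; apply: near_ffact_div_ln_le => //; rewrite ltrD2l ltr1n.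
rewrite mulrAC ler_pdivrMr ?ltr_wpDl // ler_wpM2l ?(ltW e_gt0) //.
by rewrite lerDl.
Unshelve. all: by end_near. Qed.

Lemma near_rstirling1_gt0 : \forall n \near \oo, 0 < rstirling1 n (J n) r.
Proof.
near=> n; have n_gt1 : (1 < n)%N by near: n; exact: nbhs_infty_gt.
have : 0 < rstirling1_quot n (J n).
  near: n; apply: (cvgr_gt _ cvg_rstirling1_quot).
  by rewrite invr_gt0 Gamma_gt0 // ltr_wpDr.
rewrite pmulr_lgt0 ?pmulr_lgt0 ?natr_fact_gt0 // invr_gt0 mulr_gt0 //.
  by rewrite gauss_norm_gt0 // ltnW.
by rewrite exprn_gt0 // ln_gt0 // ltr1n.
Unshelve. all: by end_near. Qed.

End rstirling1_asymptotics.

Lemma cvg_rstirling1_succ (R : realType) (r y : R) (J : nat -> nat) :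
  0 <= r -> 0 < y -> log_scale J y ->
  rstirling1 n (J n).+1 r / rstirling1 n (J n) r @[n --> \oo] --> y^-1.
Proof.
move=> r_ge0 y_gt0 Jy.
have G_gt0 : 0 < Gamma (y + r) by rewrite Gamma_gt0 // ltr_wpDr.
have Jy1 := log_scale_addn 1 Jy.
have quot_cvg : rstirling1_quot r n (J n + 1) / rstirling1_quot r n (J n)
    / ((J n + 1)%:R / ln n%:R) @[n --> \oo]
    --> (Gamma (y + r))^-1 / (Gamma (y + r))^-1 / y.
  apply: cvgM; last by apply: cvgV => //; rewrite gt_eqF.
  apply: cvgM; first exact: cvg_rstirling1_quot.
  apply: cvgV; last exact: cvg_rstirling1_quot.
  by rewrite invr_neq0 // gt_eqF.
rewrite divff ?invr_neq0 ?gt_eqF // mul1r in quot_cvg.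
apply: near_eq_cvg_to quot_cvg; near=> n.
have n_gt1 : (1 < n)%N by near: n; exact: nbhs_infty_gt.
have a_gt0 : 0 < rstirling1 n (J n) r by near: n; exact: near_rstirling1_gt0 Jy.
have L_gt0 : 0 < ln n%:R :> R by rewrite ln_gt0 // ltr1n.
rewrite /rstirling1_quot addn1 factS natrM exprSr.
have s_gt0 : 0 < (J n).+1%:R :> R by rewrite ltr0n.
move: ((J n).+1%:R : R) s_gt0 => s s_gt0.
by field; rewrite !gt_eqF ?exprn_gt0 ?natr_fact_gt0 ?gauss_norm_gt0 // ltnW.
Unshelve. all: by end_near. Qed.

Lemma cvg_rstirling1_pred (R : realType) (r y : R) (J : nat -> nat) :
  0 <= r -> 0 < y -> log_scale J y ->
  rstirling1 n (J n).-1 r / rstirling1 n (J n) r @[n --> \oo] --> y.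
Proof.
move=> r_ge0 y_gt0 Jy; rewrite -[X in _ --> X]invrK.
have succ_cvg := cvg_rstirling1_succ r_ge0 y_gt0 (log_scale_subn 1 y_gt0 Jy).
apply: near_eq_cvg_to (cvgV (invr_neq0 (lt0r_neq0 y_gt0)) succ_cvg).
near=> n; have J_gt0 : (0 < J n)%N by near: n; exact: log_scale_gtn Jy.
by rewrite /= invf_div subn1 prednK.
Unshelve. all: by end_near. Qed.

(** * Tails of log-concave sequences *)

Section log_concavity.
Variable R : realType.
Implicit Types (a : nat -> R) (p : {poly R}).

Definition log_concave a :=
  forall i l, (i <= l)%N -> a i * a l.+1 <= a i.+1 * a l.

Lemma coef_MXaddC p s i :
  (p * ('X + s%:P))`_i = (if i is i'.+1 then p`_i' else 0) + p`_i * s.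
Proof. by rewrite mulrDr coefD coefMX coefMC; case: i. Qed.

Lemma coef_MXaddC_ge0 p s : 0 <= s ->
  (forall i, 0 <= p`_i) -> forall i, 0 <= (p * ('X + s%:P))`_i.
Proof.
by move=> s_ge0 p_ge0 i; rewrite coef_MXaddC addr_ge0 ?mulr_ge0 //; case: i.
Qed.

Lemma log_concave_MXaddC p s : 0 <= s -> (forall i, 0 <= p`_i) ->
  log_concave (fun i => p`_i) -> log_concave (fun i => (p * ('X + s%:P))`_i).
Proof.
move=> s_ge0 p_ge0 p_lc i l il; rewrite !coef_MXaddC.
pose b j := if j is j'.+1 then p`_j' else 0; rewrite -!/(b _) /=.
have b_ge0 j : 0 <= b j by case: j => /=.
have shifted : b i * p`_l <= p`_i * b l.
  by case: i l il => [|i] [|l] //= il; rewrite ?mul0r ?mulr_ge0 // p_lc.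
have mixed : b i * p`_l.+1 <= p`_i.+1 * b l.
  case: i l il {shifted} => [|i] [|l] //= il; rewrite ?mul0r ?mulr_ge0 //.
  move: il; rewrite ltnS leq_eqVlt => /predU1P[->|il]; first by rewrite mulrC.
  apply: (@le_trans _ _ (p`_i.+1 * p`_l.+1)); apply: p_lc => //.
  exact: leqW (ltnW il).
have {}mixed := ler_wpM2l s_ge0 mixed.
have {p_lc} := ler_wpM2l (sqr_ge0 s) (p_lc i l il).
move: (p`_i) (p`_i.+1) (p`_l) (p`_l.+1) (b i) (b l) shifted mixed.
by move=> *; lra.
Qed.

Lemma log_concave_head_le a N m : 0 < a 0 -> 0 <= a 1 ->
  (forall i, (i.+1 < N)%N -> a 0 * a i.+1 <= a 1 * a i) ->
  (m < N)%N -> a m <= a 0 * (a 1 / a 0) ^+ m.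
Proof.
move=> a0_gt0 a1_ge0 a_lc; elim: m => [|m IH] mN; first by rewrite expr0 mulr1.
rewrite exprSr mulrA; apply: (@le_trans _ _ (a m * (a 1 / a 0))); last first.
  by rewrite ler_wpM2r ?IH ?(ltnW mN) // divr_ge0 // ltW.
by rewrite mulrA ler_pdivlMr // mulrC [leRHS]mulrC a_lc.
Qed.

End log_concavity.

Section rstirling1_log_concavity.
Variables (R : realType) (r : R).
Hypothesis r_ge0 : 0 <= r.

Lemma rstirling1_ge0 n j : 0 <= rstirling1 n j r.
Proof.
rewrite rstirling1E; elim: n j => [|n IH] j.
  by rewrite /rising big_ord0 coef1; case: eqP.
by rewrite rising_recr coef_MXaddC_ge0 // addr_ge0.
Qed.

Lemma rstirling1_log_concave n : log_concave (fun j => rstirling1 n j r).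
Proof.
move=> i l il; rewrite !rstirling1E; elim: n i l il => [|n IH].
  by move=> i l il; rewrite /rising big_ord0 !coef1 /= mulr0 mul0r.
rewrite rising_recr; apply: log_concave_MXaddC => //; first by rewrite addr_ge0.
by move=> i; rewrite -rstirling1E rstirling1_ge0.
Qed.

End rstirling1_log_concavity.

Section geometric_tails.
Variable R : realType.
Implicit Types (f b v : nat -> nat -> R) (N : nat -> nat) (C t : nat -> R).

Lemma cvg_sum_geometric f N C t (q : R) :
  0 < q < 1 ->
  (\forall n \near \oo, forall m, (m < N n)%N ->
    0 <= f n m <= C n * t n ^+ m) ->
  N n @[n --> \oo] --> \oo ->
  (forall m, f n m @[n --> \oo] --> q ^+ m) ->
  C n @[n --> \oo] --> (1 : R) -> t n @[n --> \oo] --> q ->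
  \sum_(m < N n) f n m @[n --> \oo] --> (1 - q)^-1.
Proof.
move=> /andP[q_gt0 q_lt1] f_dom N_infty f_cvg C_cvg t_cvg.
have upper_cvg : C n / (1 - t n) @[n --> \oo] --> (1 - q)^-1.
  rewrite -[X in _ --> X]mul1r; apply: cvgM => //; apply: cvgV.
    by rewrite subr_eq0 gt_eqF.
  by apply: cvgB => //; exact: cvg_cst.
have head_cvg K : \sum_(m < K) f n m @[n --> \oo] --> \sum_(m < K) q ^+ m.
  by apply: cvg_big => [|m _]; [exact: add_continuous|exact: f_cvg].
have geom_cvg : series (geometric 1 q) K @[K --> \oo] --> (1 - q)^-1.
  rewrite -[X in _ --> X]mul1r; apply: cvg_geometric_series.
  by rewrite ger0_norm // ltW.
apply/cvgrPdist_lt => e e_gt0; have e2_gt0 : 0 < e / 2 by rewrite divr_gt0.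
have [K head_gt] : exists K, (1 - q)^-1 - e / 2 < \sum_(m < K) q ^+ m.
  have [|K] := filter_ex (cvgr_gt _ geom_cvg ((1 - q)^-1 - e / 2) _).
    by rewrite gtrBl.
  rewrite /series /= big_mkord; under eq_bigr do rewrite mul1r.
  by exists K.
have {}head_cvg := head_cvg K.
near=> n; have f_dom_n m : (m < N n)%N -> 0 <= f n m <= C n * t n ^+ m.
  by move: m; near: n.
have C_gt0 : 0 < C n by near: n; exact: (cvgr_gt _ C_cvg).
have t_gt0 : 0 < t n by near: n; exact: (cvgr_gt _ t_cvg).
have t_lt1 : t n < 1 by near: n; exact: (cvgr_lt _ t_cvg).
have KN : (K <= N n)%N by near: n; move/cvgnyPge : N_infty; exact.
have head_near : \sum_(m < K) q ^+ m - e / 2 < \sum_(m < K) f n m.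
  by near: n; apply: (cvgr_gt _ head_cvg); rewrite gtrBl.
have upper_near : C n / (1 - t n) < (1 - q)^-1 + e.
  by near: n; apply: (cvgr_lt _ upper_cvg); rewrite ltrDl.
have lower : \sum_(m < K) f n m <= \sum_(m < N n) f n m.
  rewrite -!(big_mkord xpredT (f n)) (big_cat_nat _ KN) //= lerDl big_nat.
  by apply: sumr_ge0 => m /andP[_ /f_dom_n /andP[]].
have upper : \sum_(m < N n) f n m <= C n / (1 - t n).
  apply: le_trans (geometric_le_lim (N n) (ltW C_gt0) t_gt0 _); last first.
    by rewrite ger0_norm // ltW.
  rewrite /series /= big_mkord; apply: ler_sum => m _.
  by have /andP[] := f_dom_n m (ltn_ord m).
by rewrite ltr_norml; lra.
Unshelve. all: by end_near. Qed.

Lemma gt0_div_neq0 (y z : R) : 0 < y / z -> z != 0.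
Proof. by apply: contraTneq => ->; rewrite invr0 mulr0 ltxx. Qed.

Lemma cvg_expr_of_ratio b (q : R) : 0 < q ->
  (forall m, b n m.+1 / b n m @[n --> \oo] --> q) ->
  forall m, b n m / b n 0 @[n --> \oo] --> q ^+ m.
Proof.
move=> q_gt0 b_ratio.
have b_neq0 m : \forall n \near \oo, b n m != 0.
  near=> n; apply: (@gt0_div_neq0 (b n m.+1)).
  by near: n; exact: (cvgr_gt _ (b_ratio m)).
elim=> [|m IH].
  rewrite expr0; apply: near_eq_cvg_to (cvg_cst (1 : R)).
  by apply: filterS (b_neq0 0) => n b0; rewrite divff.
rewrite exprS; apply: near_eq_cvg_to (cvgM (b_ratio m) IH).
by apply: filterS (b_neq0 m) => n bm /=; rewrite mulrA divfK.
Unshelve. all: by end_near. Qed.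

Lemma cvg_sum_log_concave b v N C (q s : R) :
  0 < q -> 0 < s -> q * s < 1 ->
  (\forall n \near \oo, forall m, (m < N n)%N -> 0 <= b n m) ->
  (\forall n \near \oo, forall m, (m.+1 < N n)%N ->
    b n 0 * b n m.+1 <= b n 1 * b n m) ->
  (\forall n \near \oo, forall m, (m < N n)%N -> 0 <= v n m <= C n * s ^+ m) ->
  N n @[n --> \oo] --> \oo ->
  (forall m, b n m.+1 / b n m @[n --> \oo] --> q) ->
  (forall m, v n m @[n --> \oo] --> s ^+ m) ->
  C n @[n --> \oo] --> (1 : R) ->
  \sum_(m < N n) b n m / b n 0 * v n m @[n --> \oo] --> (1 - q * s)^-1.
Proof.
move=> q_gt0 s_gt0 qs_lt1 b_ge0 b_lc v_le N_infty b_ratio v_cvg C_cvg.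
have b_cvg := cvg_expr_of_ratio q_gt0 b_ratio.
apply: (@cvg_sum_geometric (fun n m => b n m / b n 0 * v n m) N C
  (fun n => b n 1 / b n 0 * s)) => //.
- by rewrite mulr_gt0.
- near=> n => m mN.
  have N_gt1 : (1 < N n)%N by near: n; move/cvgnyPgt : N_infty; exact.
  have b_ge0_n : forall m, (m < N n)%N -> 0 <= b n m by near: n.
  have b_lc_n : forall m, (m.+1 < N n)%N -> b n 0 * b n m.+1 <= b n 1 * b n m.
    by near: n.
  have b0_gt0 : 0 < b n 0.
    rewrite lt0r b_ge0_n ?(ltnW N_gt1) // andbT.
    apply: (@gt0_div_neq0 (b n 1)).
    by near: n; exact: (cvgr_gt _ (b_ratio 0)).
  have v_le_n : forall m, (m < N n)%N -> 0 <= v n m <= C n * s ^+ m by near: n.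
  have /andP[v_ge0 v_leC] := v_le_n m mN.
  rewrite mulr_ge0 ?divr_ge0 ?b_ge0_n ?(ltW b0_gt0) ?(ltnW N_gt1) //=.
  rewrite exprMn mulrCA; apply: ler_pM => //.
    by rewrite divr_ge0 ?(b_ge0_n _ mN) ?(ltW b0_gt0).
  rewrite ler_pdivrMr // mulrC.
  by apply: log_concave_head_le mN => //; exact: b_ge0_n.
- by move=> m; rewrite exprMn; apply: cvgM.
- by apply: cvgM; [exact: b_ratio|exact: cvg_cst].
Unshelve. all: by end_near. Qed.

End geometric_tails.

(** * The r-Lah distribution *)

Section rlah_asymptotics.
Variables (R : realType) (k : nat) (r : R).
Hypothesis r_ge0 : 0 <= r.
Local Notation c := (k%:R + r).
Hypothesis c_gt0 : 0 < c.

Let cr_gt0 : 0 < c + r. Proof. by rewrite ltr_wpDr. Qed.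

Lemma fact_rlahE n : k`!%:R * rlah n k r
  = \sum_(j < n.+1) rstirling1 n j r * (k`!%:R * rstirling2 j k r).
Proof.
rewrite /rlah big_nat_trim_lt => [|j jk]; last first.
  by rewrite /rstirling2 big_geq ?mulr0.
by rewrite mulr_sumr; apply: eq_bigr => j _; rewrite mulrCA.
Qed.

Lemma fact_rlah_le n : k`!%:R * rlah n k r <= \prod_(i < n) (c + r + i%:R).
Proof.
rewrite fact_rlahE -sum_rstirling1; apply: ler_sum => j _.
by rewrite ler_wpM2l ?rstirling1_ge0 // fact_rstirling2_le.
Qed.

Lemma fact_rlah_ge n :
  \prod_(i < n) (c + r + i%:R) - k%:R * \prod_(i < n) (c + r - 1 + i%:R)
    <= k`!%:R * rlah n k r.
Proof.
rewrite fact_rlahE [c + r - 1]addrAC -!sum_rstirling1 mulr_sumr -sumrB.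
apply: ler_sum => j _; rewrite [k%:R * _]mulrCA -mulrBr.
by rewrite ler_wpM2l ?rstirling1_ge0 // fact_rstirling2_ge.
Qed.

Lemma cvg_rlah :
  k`!%:R * rlah n k r / \prod_(i < n) (c + r + i%:R) @[n --> \oo] --> (1 : R).
Proof.
set x := c + r - 1.
have shift_cvg0 : x / (x + n%:R) @[n --> \oo] --> (0 : R).
  rewrite -(mulr0 x); apply: cvgM; first exact: cvg_cst.
  have x_infty : x + n%:R @[n --> \oo] --> (+oo : set_system R).
    apply/cvgryPge => A; near=> n; rewrite addrC -lerBlDr.
    by near: n; exact: nbhs_infty_ger.
  by apply/gtr0_cvgV0; [exact: (cvgry_gt x_infty)|exact: x_infty].
apply: (@squeeze_cvgr _ _ _ _ (fun n => 1 - k%:R * (x / (x + n%:R))) (cst 1)).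
- near=> n; have n_gt1 : (1 < n)%N by near: n; exact: nbhs_infty_gt.
  have xn_gt0 : 0 < x + n%:R.
    by rewrite addrAC -addrA ltr_pwDl ?subr_ge0 ?ler1n // ltnW.
  rewrite ler_pdivrMr ?prod_addn_gt0 // mul1r fact_rlah_le andbT.
  rewrite ler_pdivlMr ?prod_addn_gt0 //.
  apply: le_trans (fact_rlah_ge n); rewrite -/x mulrBl mul1r -mulrA lerB //.
  rewrite ler_wpM2l // mulrAC ler_pdivlMr //.
  by rewrite -prod_addn_shift subrK.
- rewrite -[X in _ --> X]subr0; apply: cvgB; first exact: cvg_cst.
  by rewrite -(mulr0 k%:R); apply: cvgM; first exact: cvg_cst.
- exact: cvg_cst.
Unshelve. all: by end_near. Qed.

Lemma near_rlah_gt0 : \forall n \near \oo, 0 < rlah n k r.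
Proof.
near=> n; have : 0 < k`!%:R * rlah n k r / \prod_(i < n) (c + r + i%:R).
  by near: n; exact: (cvgr_gt _ cvg_rlah).
rewrite pmulr_lgt0 ?invr_gt0 ?prod_addn_gt0 //.
by rewrite pmulr_rgt0 // natr_fact_gt0.
Unshelve. all: by end_near. Qed.

Definition lah_pmf n j : R :=
  (rlah n k r)^-1 * (rstirling1 n j r * rstirling2 j k r).

Lemma lah_pmf_ratio n i j : rlah n k r != 0 -> lah_pmf n i / lah_pmf n j
  = rstirling1 n i r / rstirling1 n j r * (rstirling2 i k r / rstirling2 j k r).
Proof.
move=> Z_neq0; rewrite /lah_pmf -mulf_div divff ?invr_neq0 // mul1r.
by rewrite mulf_div.
Qed.

Lemma lah_pmf_poisson_ratio n j : (1 < n)%N -> 0 < rlah n k r ->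
  lah_pmf n j / poisson_pmf (c * ln n%:R) j
    = rstirling1_quot r n j * rstirling2_quot r k j
      / (k`!%:R * rlah n k r / \prod_(i < n) (c + r + i%:R)
         * gauss_quot (c + r) n).
Proof.
move=> n_gt1 Z_gt0; have nR_gt0 : 0 < n%:R :> R by rewrite ltr0n ltnW.
have L_gt0 : 0 < ln n%:R :> R by rewrite ln_gt0 // ltr1n.
rewrite poisson_pmfE ?mulr_gt0 // /lah_pmf /rstirling1_quot /rstirling2_quot.
rewrite /gauss_quot [in gauss_norm (c + r) _]addrC gauss_normD ?(ltnW n_gt1) //.
rewrite gt0_powRE // expRN exprMn.
have norm_gt0 := gauss_norm_gt0 r (ltnW n_gt1).
by field; rewrite !gt_eqF ?exprn_gt0 ?expR_gt0 ?natr_fact_gt0 ?prod_addn_gt0.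
Qed.

Let expr_addn_ratio n m : c ^+ (n + m) / c ^+ n = c ^+ m.
Proof. by rewrite exprD mulrAC divff ?mul1r // expf_neq0 // gt_eqF. Qed.

Let expr_subn_ratio n m : (m <= n)%N -> c ^+ (n - m) / c ^+ n = c^-1 ^+ m.
Proof.
move=> mn; rewrite exprVn -[in X in _ / X](subnK mn) exprD invfM mulrA.
by rewrite divff ?mul1r // expf_neq0 // gt_eqF.
Qed.

Variables (J : nat -> nat) (x : R).
Hypotheses (x_gt0 : 0 < x) (Jx : log_scale J (c * x)).

Let cx_gt0 : 0 < c * x. Proof. by rewrite mulr_gt0. Qed.
Let J_infty : J n @[n --> \oo] --> \oo. Proof. exact: log_scale_cvgny Jx. Qed.

Lemma cvg_lah_pmf_poisson_ratio :
  lah_pmf n (J n) / poisson_pmf (c * ln n%:R) (J n) @[n --> \oo]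
    --> Gamma (c + r) / Gamma (c * x + r).
Proof.
have G_gt0 := Gamma_gt0 cr_gt0.
have -> : Gamma (c + r) / Gamma (c * x + r)
    = (Gamma (c * x + r))^-1 * 1 / (1 * (Gamma (c + r))^-1).
  by rewrite mulr1 mul1r invrK mulrC.
have quot_cvg : rstirling1_quot r n (J n) * rstirling2_quot r k (J n)
    / (k`!%:R * rlah n k r / \prod_(i < n) (c + r + i%:R)
       * gauss_quot (c + r) n)
    @[n --> \oo] --> (Gamma (c * x + r))^-1 * 1 / (1 * (Gamma (c + r))^-1).
  apply: cvgM.
    apply: cvgM; first exact: cvg_rstirling1_quot.
    exact: cvg_comp J_infty (cvg_rstirling2_quot r_ge0 c_gt0).
  apply: cvgV; first by rewrite mul1r invr_neq0 ?gt_eqF.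
  by apply: cvgM; [exact: cvg_rlah|exact: cvg_gauss_quot].
apply: near_eq_cvg_to quot_cvg; near=> n.
rewrite lah_pmf_poisson_ratio //.
  by near: n; exact: nbhs_infty_gt.
by near: n; exact: near_rlah_gt0.
Unshelve. all: by end_near. Qed.

Lemma cvg_rstirling2_ratio (I : nat -> nat) (z : R) :
  I n @[n --> \oo] --> \oo ->
  c ^+ I n / c ^+ J n @[n --> \oo] --> z ->
  rstirling2 (I n) k r / rstirling2 (J n) k r @[n --> \oo] --> z.
Proof.
move=> I_infty cX_cvg; have quot_cvg := cvg_rstirling2_quot r_ge0 c_gt0.
rewrite -[z]mul1r -[X in X * _]divr1.
under eq_fun do rewrite rstirling2_ratioE //.
apply: cvgM => //; apply: cvgM; first exact: cvg_comp I_infty quot_cvg.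
by apply: cvgV; [exact: oner_neq0|exact: cvg_comp J_infty quot_cvg].
Qed.

Let rstirling2_quotV_cvg :
  (rstirling2_quot r k (J n))^-1 @[n --> \oo] --> (1 : R).
Proof.
rewrite -[X in _ --> X]invr1; apply: cvgV; first exact: oner_neq0.
exact: cvg_comp J_infty (cvg_rstirling2_quot r_ge0 c_gt0).
Qed.

Lemma cvg_lah_upper_tail : 1 < x ->
  (\sum_(J n <= j < n.+1) lah_pmf n j) / lah_pmf n (J n) @[n --> \oo]
    --> x / (x - 1).
Proof.
move=> x_gt1.
have -> : x / (x - 1) = (1 - (c * x)^-1 * c)^-1.
  by field; rewrite !gt_eqF //; lra.
have tail_cvg := @cvg_sum_log_concave _ (fun n m => rstirling1 n (J n + m) r)
  (fun n m => rstirling2 (J n + m) k r / rstirling2 (J n) k r)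
  (fun n => n.+1 - J n)%N (fun n => (rstirling2_quot r k (J n))^-1)
  (c * x)^-1 c.
apply: near_eq_cvg_to (tail_cvg _ _ _ _ _ _ _ _ _ rstirling2_quotV_cvg) => //.
- near=> n; have Z_neq0 : rlah n k r != 0.
    by apply: lt0r_neq0; near: n; exact: near_rlah_gt0.
  rewrite -[J n in RHS]add0n big_addn big_mkord mulr_suml.
  by apply: eq_bigr => m _; rewrite lah_pmf_ratio // addn0 [(m + _)%N]addnC.
- by rewrite invr_gt0.
- by rewrite invfM mulrAC mulVf ?mul1r ?gt_eqF // invf_lt1.
- by near=> n => m _; exact: rstirling1_ge0.
- near=> n => m _; rewrite addn0 addn1 addnS.
  by apply: rstirling1_log_concave => //; exact: leq_addr.
- near=> n => m _.
  have := rstirling2_ratio_itv r_ge0 (J n + m) (J n) c_gt0.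
  by rewrite expr_addn_ratio.
- apply/cvgnyPgt => A; near=> n; rewrite ltn_subRL; apply: leqW.
  by near: n; exact: log_scale_ltn Jx.
- move=> m; under eq_fun do rewrite addnS.
  exact: cvg_rstirling1_succ r_ge0 cx_gt0 (log_scale_addn m Jx).
- move=> m; apply: cvg_rstirling2_ratio.
    exact/(log_scale_cvgny cx_gt0)/log_scale_addn.
  by under eq_fun do rewrite expr_addn_ratio; exact: cvg_cst.
Unshelve. all: by end_near. Qed.

Lemma cvg_lah_lower_tail : x < 1 ->
  (\sum_(k <= j < (J n).+1) lah_pmf n j) / lah_pmf n (J n) @[n --> \oo]
    --> 1 / (1 - x).
Proof.
move=> x_lt1; rewrite div1r.
have rev_index n m :
  (m < n.+1 - k)%N -> (n - (n.+1 - k - m.+1) = m + k)%N by lia.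
have cxV : c * x * c^-1 = x by rewrite mulrAC divff ?mul1r ?gt_eqF.
rewrite -{1}cxV.
have tail_cvg := @cvg_sum_log_concave _ (fun n m => rstirling1 n (J n - m) r)
  (fun n m => rstirling2 (J n - m) k r / rstirling2 (J n) k r)
  (fun n => (J n).+1 - k)%N (fun n => (rstirling2_quot r k (J n))^-1)
  (c * x) c^-1.
apply: near_eq_cvg_to (tail_cvg _ _ _ _ _ _ _ _ _ rstirling2_quotV_cvg) => //.
- near=> n; have Z_neq0 : rlah n k r != 0.
    by apply: lt0r_neq0; near: n; exact: near_rlah_gt0.
  rewrite -[k in RHS]add0n big_addn big_mkord mulr_suml.
  rewrite (reindex_inj rev_ord_inj).
  by apply: eq_bigr => m _; rewrite lah_pmf_ratio // subn0 /= rev_index.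
- by rewrite invr_gt0.
- by rewrite cxV.
- by near=> n => m _; exact: rstirling1_ge0.
- near=> n => m; rewrite ltn_subRL ltnS => mk_lt.
  have mJ : (m < J n)%N by rewrite (leq_trans _ mk_lt) // leq_addl.
  rewrite subn0 subn1 mulrC [leRHS]mulrC.
  rewrite -[in rstirling1 n (J n) r](ltn_predK mJ) -(subnSK mJ).
  by apply: rstirling1_log_concave => //; rewrite -subn1 leq_sub2l.
- near=> n => m; rewrite ltn_subRL ltnS => mk_le.
  have mJ : (m <= J n)%N by rewrite (leq_trans _ mk_le) // leq_addl.
  have := rstirling2_ratio_itv r_ge0 (J n - m) (J n) c_gt0.
  by rewrite expr_subn_ratio.
- apply/cvgnyPgt => A; near=> n; rewrite ltn_subRL; apply: leqW.
  by near: n; exact: log_scale_gtn Jx.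
- move=> m; under eq_fun do rewrite subnS.
  exact: cvg_rstirling1_pred r_ge0 cx_gt0 (log_scale_subn m cx_gt0 Jx).
- move=> m; apply: cvg_rstirling2_ratio.
    exact/(log_scale_cvgny cx_gt0)/log_scale_subn.
  apply: near_eq_cvg_to (cvg_cst _); near=> n; rewrite expr_subn_ratio //.
  by rewrite ltnW //; near: n; exact: log_scale_gtn Jx.
Unshelve. all: by end_near. Qed.

End rlah_asymptotics.

Section discrete_probability.
Variables (R : realType) (d : measure_display) (T : measurableType d).
Variables (P : probability T R) (X : {RV P >-> R}) (m n : nat) (p : nat -> R).
Hypothesis Xp : forall j, (m <= j < n)%N -> P [set w | X w = j%:R] = (p j)%:E.

Let measurable_preimage (D : set R) : measurable D -> measurable (X @^-1` D).
Proof.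
by move=> mD; rewrite -[X in measurable X]setTI; apply: measurable_funP.
Qed.

Lemma sum_pmf_le_prob (D : set R) : measurable D ->
  ((\sum_(m <= j < n | j%:R \in D) p j)%:E <= P (X @^-1` D))%E.
Proof.
move=> mD; rewrite big_geq_mkord -sumEFin.
under eq_bigr => j /andP[_ mj] do rewrite -Xp ?mj ?ltn_ord //.
have measurable_eq j : measurable [set w | X w = j%:R].
  exact: measurable_preimage (measurable_set1 _).
rewrite -measure_bigsetU_ord_cond => [|j _|i j _ _ [w [/= -> /eqP]]] //.
- apply: le_measure; rewrite ?inE.
  + by apply: bigsetU_measurable => j _.
  + exact: measurable_preimage.
  + elim/big_ind: _ => [//|B C BD CD|j /andP[/set_mem Dj _] w /= ->//].
    by rewrite subUset.
- by rewrite eqr_nat => /eqP/val_inj.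
Qed.

Lemma prob_sum_pmf (D : set R) : measurable D ->
  \sum_(m <= j < n) p j = 1 ->
  fine (P (X @^-1` D)) = \sum_(m <= j < n | j%:R \in D) p j.
Proof.
move=> mD p1; have mXD := measurable_preimage mD.
have PXD_fine : P (X @^-1` D) = (fine (P (X @^-1` D)))%:E.
  by rewrite fineK // fin_num_measure.
have := sum_pmf_le_prob (measurableC mD).
have := sum_pmf_le_prob mD.
rewrite preimage_setC probability_setC // PXD_fine -EFinB !lee_fin /=.
move: p1; rewrite (bigID (fun j => j%:R \in D)) /=.
under [X in _ + X]eq_bigl do rewrite -in_setC.
by move=> *; lra.
Qed.

End discrete_probability.

Section lah_probability.
Variables (R : realType) (k n : nat) (r : R).
Variables (d : measure_display) (T : measurableType d) (P : probability T R).
Variable X : {RV P >-> R}.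
Hypotheses (XP : rLah_distributed n k r X) (Z_neq0 : rlah n k r != 0).

Lemma prob_lah (D : set R) : measurable D ->
  fine (P (X @^-1` D)) = \sum_(k <= j < n.+1 | j%:R \in D) lah_pmf k r n j.
Proof.
move=> mD; apply: (prob_sum_pmf (p := lah_pmf k r n)) => //.
by rewrite -mulr_sumr mulVf.
Qed.

Lemma prob_lah_ge i : (k <= i)%N ->
  fine (P [set w | i%:R <= X w]) = \sum_(i <= j < n.+1) lah_pmf k r n j.
Proof.
move=> ki; rewrite (big_nat_widenl i k) //=.
rewrite (@prob_lah [set y | i%:R <= y]) -?set_itvcy ?measurable_itv //.
apply: eq_bigl => j.
by apply/idP/idP; rewrite in_setE /= ?in_itv /= ?andbT ler_nat.
Qed.

Lemma prob_lah_le i : (i <= n)%N ->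
  fine (P [set w | X w <= i%:R]) = \sum_(k <= j < i.+1) lah_pmf k r n j.
Proof.
move=> i_le_n; rewrite (big_nat_widen k _ n.+1) //=.
rewrite (@prob_lah [set y | y <= i%:R]) -?set_itvNyc ?measurable_itv //.
apply: eq_bigl => j.
by apply/idP/idP; rewrite in_setE /= ?in_itv /= ler_nat ltnS.
Qed.

End lah_probability.

Section lah_pmf_asymptotics.
Variables (R : realType) (k : nat) (r : R).
Hypothesis r_ge0 : 0 <= r.
Local Notation c := (k%:R + r).
Hypothesis c_gt0 : 0 < c.
Variables (J : nat -> nat) (x_ : nat -> R) (x : R).
Hypotheses (x_gt0 : 0 < x) (x_cvg : x_ n @[n --> \oo] --> x).
Hypothesis JE : \forall n \near \oo, (J n)%:R = c * x_ n * ln n%:R.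

Lemma log_scale_lah : log_scale J (c * x).
Proof.
apply: near_eq_cvg_to (cvgM (cvg_cst c) x_cvg); near=> n => /=.
have -> : (J n)%:R = c * x_ n * ln n%:R by near: n.
rewrite mulfK // gt_eqF // ln_gt0 // ltr1n.
by near: n; exact: nbhs_infty_gt.
Unshelve. all: by end_near. Qed.

Definition lah_asymp n : R :=
  n%:R `^ (- (c * (x_ n * ln (x_ n) - x_ n + 1)))
    / Num.sqrt (2 * pi * c * x * ln n%:R)
  * (Gamma (k%:R + 2 * r) / Gamma (c * x + r)).

Lemma asymp_equiv_lah_pmf :
  asymp_equiv (fun n => lah_pmf k r n (J n)) lah_asymp.
Proof.
pose G := Gamma (c + r) / Gamma (c * x + r).
have cx_gt0 : 0 < c * x by rewrite mulr_gt0.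
have G_neq0 : G != 0.
  by rewrite mulf_neq0 ?invr_neq0 // gt_eqF // Gamma_gt0 // ltr_wpDr.
have rate_infty : c * ln n%:R @[n --> \oo] --> +oo.
  have := cvg_comp _ _ (@cvgn_ln R) (gt0_cvgMry c_gt0 (@cvg_id _ _)).
  exact.
have JE_rate : \forall n \near \oo, (J n)%:R = x_ n * (c * ln n%:R).
  by apply: filterS JE => n ->; rewrite mulrCA mulrA.
have pmf_equiv := cvg_asymp_equiv G_neq0
  (cvg_lah_pmf_poisson_ratio r_ge0 c_gt0 x_gt0 log_scale_lah).
have poisson_equiv := asymp_equivZl G_neq0
  (asymp_equiv_poisson_pmf x_gt0 x_cvg rate_infty JE_rate).
apply: (asymp_equiv_trans pmf_equiv); apply: near_eq_cvg_to poisson_equiv.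
near=> n; have n_gt0 : (0 < n)%N by near: n; exact: nbhs_infty_gt.
rewrite /lah_asymp gt0_powRE ?ltr0n // mulNr [c * _ * ln _]mulrAC.
have -> : 2 * pi * c * x * ln n%:R = 2 * pi * x * (c * ln n%:R) by ring.
have -> : k%:R + 2 * r = c + r by ring.
by congr (_ / _); rewrite mulrC.
Unshelve. all: by end_near. Qed.

Lemma asymp_equiv_lah_upper_tail : 1 < x ->
  asymp_equiv (fun n => \sum_(J n <= j < n.+1) lah_pmf k r n j)
    (fun n => x / (x - 1) * lah_asymp n).
Proof.
move=> x_gt1; have q_neq0 : x / (x - 1) != 0.
  by rewrite mulf_neq0 ?invr_neq0 ?gt_eqF ?subr_gt0.
apply: asymp_equiv_trans (asymp_equivZl q_neq0 asymp_equiv_lah_pmf).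
apply: cvg_asymp_equiv => //.
exact: cvg_lah_upper_tail log_scale_lah x_gt1.
Qed.

Lemma asymp_equiv_lah_lower_tail : x < 1 ->
  asymp_equiv (fun n => \sum_(k <= j < (J n).+1) lah_pmf k r n j)
    (fun n => 1 / (1 - x) * lah_asymp n).
Proof.
move=> x_lt1; have q_neq0 : 1 / (1 - x) != 0.
  by rewrite mulf_neq0 ?invr_neq0 ?gt_eqF ?subr_gt0.
apply: asymp_equiv_trans (asymp_equivZl q_neq0 asymp_equiv_lah_pmf).
apply: cvg_asymp_equiv => //.
exact: cvg_lah_lower_tail log_scale_lah x_lt1.
Qed.

Lemma near_lah_support : \forall n \near \oo,
  [/\ (0 < n)%N, (k <= J n)%N, (J n <= n)%N & rlah n k r != 0].
Proof.
have cx_gt0 : 0 < c * x by rewrite mulr_gt0.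
near=> n; split.
- by near: n; exact: nbhs_infty_gt.
- by rewrite ltnW //; near: n; exact: log_scale_gtn log_scale_lah.
- by rewrite ltnW // -[J n]addn0; near: n; exact: log_scale_ltn log_scale_lah.
- by rewrite lt0r_neq0 //; near: n; exact: near_rlah_gt0.
Unshelve. all: by end_near. Qed.

End lah_pmf_asymptotics.

Lemma max_gt0_addr_gt0 (R : realDomainType) (a b : R) :
  0 <= a -> 0 <= b -> 0 < Num.max a b -> 0 < a + b.
Proof.
move=> a_ge0 b_ge0; rewrite lt_max => /orP[a_gt0|b_gt0].
  exact: ltr_wpDr.
exact: ltr_wpDl.
Qed.

Lemma near_natr_of_int (R : realType) (c x : R) (x_ : nat -> R) :
  0 <= c -> 0 < x -> x_ n @[n --> \oo] --> x ->
  (forall n, (0 < n)%N -> c * x_ n * ln n%:R \is a Num.int) ->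
  exists J : nat -> nat, \forall n \near \oo, (J n)%:R = c * x_ n * ln n%:R.
Proof.
move=> c_ge0 x_gt0 x_cvg x_int.
exists (fun n => Num.truncn (c * x_ n * ln n%:R)); near=> n.
have n_gt0 : (0 < n)%N by near: n; exact: nbhs_infty_gt.
apply: truncnK; rewrite natrEint x_int // !mulr_ge0 ?ln_ge0 ?ler1n //.
by near: n; exact: (cvgr_ge _ x_cvg).
Unshelve. all: by end_near. Qed.

Theorem theorem3p22 (R : realType) (k : nat) (r : R)
    (r_ge0 : 0 <= r) (kr_gt0 : 0 < Num.max k%:R r)
    (d : nat -> measure_display) (T : forall n : nat, measurableType (d n))
    (P : forall n : nat, probability (T n) R)
    (Lah : forall n : nat, {RV (P n) >-> R})
    (LahP : forall n : nat, (0 < n)%N -> (k <= n)%N ->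
       rLah_distributed n k r (Lah n))
    (x_ : nat -> R) (x : R) (x_gt0 : 0 < x)
    (x_cvg : x_ n @[n --> \oo] --> x)
    (x_int : forall n : nat, (0 < n)%N ->
       (k%:R + r) * x_ n * ln n%:R \is a Num.int) :
  [/\ asymp_equiv
        (fun n => fine (P n [set w | Lah n w = (k%:R + r) * x_ n * ln n%:R]))
        (fun n =>
           n%:R `^ (- ((k%:R + r) * (x_ n * ln (x_ n) - x_ n + 1)))
             / Num.sqrt (2 * pi * (k%:R + r) * x * ln n%:R)
           * (Gamma (k%:R + 2 * r) / Gamma ((k%:R + r) * x + r))),
      1 < x -> asymp_equiv
        (fun n => fine (P n [set w | Lah n w >= (k%:R + r) * x_ n * ln n%:R]))
        (fun n =>
           x / (x - 1)
           * (n%:R `^ (- ((k%:R + r) * (x_ n * ln (x_ n) - x_ n + 1)))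
                / Num.sqrt (2 * pi * (k%:R + r) * x * ln n%:R))
           * (Gamma (k%:R + 2 * r) / Gamma ((k%:R + r) * x + r)))
    & x < 1 -> asymp_equiv
        (fun n => fine (P n [set w | Lah n w <= (k%:R + r) * x_ n * ln n%:R]))
        (fun n =>
           1 / (1 - x)
           * (n%:R `^ (- ((k%:R + r) * (x_ n * ln (x_ n) - x_ n + 1)))
                / Num.sqrt (2 * pi * (k%:R + r) * x * ln n%:R))
           * (Gamma (k%:R + 2 * r) / Gamma ((k%:R + r) * x + r)))].
Proof.
have c_gt0 : 0 < k%:R + r by exact: max_gt0_addr_gt0.
have [J JE] := near_natr_of_int (ltW c_gt0) x_gt0 x_cvg x_int.
have support := near_lah_support r_ge0 c_gt0 x_gt0 x_cvg JE.
have pmf_equiv := asymp_equiv_lah_pmf r_ge0 c_gt0 x_gt0 x_cvg JE.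
have upper_equiv := asymp_equiv_lah_upper_tail r_ge0 c_gt0 x_gt0 x_cvg JE.
have lower_equiv := asymp_equiv_lah_lower_tail r_ge0 c_gt0 x_gt0 x_cvg JE.
split=> [|x_gt1|x_lt1].
- apply: near_eq_asymp_equiv pmf_equiv.
  apply: filterS2 support JE => n [n_gt0 kJ Jn _] <-.
  by rewrite (LahP n n_gt0 (leq_trans kJ Jn)) // kJ.
- under [X in asymp_equiv _ X]eq_fun do rewrite -mulrA.
  apply: near_eq_asymp_equiv (upper_equiv x_gt1).
  apply: filterS2 support JE => n [n_gt0 kJ Jn Z_neq0] <-.
  by rewrite (prob_lah_ge (LahP n n_gt0 (leq_trans kJ Jn))).
- under [X in asymp_equiv _ X]eq_fun do rewrite -mulrA.
  apply: near_eq_asymp_equiv (lower_equiv x_lt1).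
  apply: filterS2 support JE => n [n_gt0 kJ Jn Z_neq0] <-.
  by rewrite (prob_lah_le (LahP n n_gt0 (leq_trans kJ Jn))).
Qed.
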